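(* Let $\{\eta(t):t\ge0\}$ be an interacting particle system on $\mathbb Z^d$, started from its stationary measure $\nu_\rho$, which admits an orthogonal self-duality function $D:\Omega_f\times\Omega\to\mathbb R$, and assume that its transition probabilities between finite configurations satisfy, for all $\xi,\xi'\in\Omega_f$ and $t\ge0$, $$p_t(\xi,\xi')\le\frac C{(1+t)^{\|\xi\|d/2}} .$$ Let $k\ge1$ and $\phi\in\mathcal S(\mathbb R^d)$, and for $\mathbf x\in(\mathbb Z^d)^k$ let $X_N(\mathbf x,\eta,\phi)=\sum_{z\in\mathbb Z^d}\phi(\tfrac zN)D(\hat\tau_z\mathbf x,\eta)$. Then for all $T>0$ there exists $C(T)$ such that for all $\mathbf x\in(\mathbb Z^d)^k$ and for all $N$ big enough $$\frac1{N^d}\int_0^T\int_0^T\mathbb E_{\nu_\rho}\left[X_N(\mathbf x,\eta(N^2t),\phi)\,X_N(\mathbf x,\eta(N^2s),\phi)\right]ds\,dt\le C(T)\,N^{-\frac{2(k-1)d}{2+(k-1)d}}.$$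
   Context: $\Omega$ is the configuration space of the particle system, whose elements $\eta$ have $\eta_x\in\{0,1,2,\dots\}$ particles at $x\in\mathbb Z^d$; the dynamics moves particles on $\mathbb Z^d$, is translation invariant and conserves the number of particles. $\Omega_f$ is the set of configurations with finitely many particles, $\|\xi\|=\sum_x\xi_x$, and $p_t(\xi,\xi')$ is the transition probability of the process from $\xi$ to $\xi'$ in time $t$, for $\xi,\xi'\in\Omega_f$. $\nu_\rho$ is a stationary homogeneous product measure and $\mathbb E_{\nu_\rho}$ is expectation for the process with $\eta(0)\sim\nu_\rho$. $\mathcal S(\mathbb R^d)$ is the space of (real) Schwartz functions. An orthogonal self-duality function is $D:\Omega_f\times\Omega\to\mathbb R$ such that: (i) self-duality: $\mathbb E_\eta[D(\xi,\eta(t))]=\mathbb E_\xi[D(\xi(t),\eta)]$ for all $\xi\in\Omega_f$, $\eta\in\Omega$ (with $\eta$ such that the process started from it is well defined; $\xi(t)$ is the process started from $\xi$); (ii) factorized polynomials: $D(\xi,\eta)=\prod_{i\in\mathbb Z^d}d(\xi_i,\eta_i)$ with $d(0,n)=1$ and $d(k,\cdot)$ a polynomial of degree $k$; (iii) orthogonality: $\int D(\xi,\eta)D(\xi',\eta)\,d\nu_\rho(\eta)=\delta_{\xi,\xi'}a(\xi)$ with $a(\xi)=\|D(\xi,\cdot)\|^2_{L^2(\nu_\rho)}$. For $\mathbf x=(x_1,\dots,x_k)\in(\mathbb Z^d)^k$, $D(\mathbf x,\eta):=D(\sum_{i=1}^k\delta_{x_i},\eta)$ and $\hat\tau_z\mathbf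 x=(z+x_1,\dots,z+x_k)$. The constant $C(T)$ may depend on $k,\phi,\rho,d$ and the process, but not on $N$. *)

(* Defs.v *)
From HB Require Import structures.
From mathcomp Require Import all_boot all_order all_algebra.
From mathcomp Require Import all_classical all_reals all_analysis.
Set Implicit Arguments.
Unset Strict Implicit.
Unset Printing Implicit Defensive.
Import Order.TTheory GRing.Theory Num.Theory.
Import numFieldNormedType.Exports.
Local Open Scope classical_set_scope.
Local Open Scope ring_scope.

Notation site d := 'rV[int]_d.

(* The configuration space carries the product sigma-algebra, generated by
   the one-site cylinders. *)
Definition cylinders (d : nat) : set (set (site d -> nat)) :=
  [set A | exists x n, A = [set eta | eta x = n]].

Arguments cylinders : clear implicits.

Notation conf d := (g_sigma_algebraType (cylinders d)).

Section configurations.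
Variable d : nat.

Definition finite_conf : set (conf d) :=
  [set xi | finite_set [set x | xi x <> 0%N]].

Definition mass (xi : conf d) : nat := \big[addn/0%N]_(x \in [set: site d]) xi x.

Definition translate (z : site d) (eta : conf d) : conf d := fun x => eta (x - z).

(* \sum_(i < k) delta_(x_i) *)
Definition conf_of (k : nat) (x : 'I_k -> site d) : conf d :=
  fun y => (\sum_(i < k) (x i == y))%N.

Definition shift_points (k : nat) (z : site d) (x : 'I_k -> site d)
  : 'I_k -> site d := fun i => z + x i.

End configurations.

Section particle_system.
Context {R : realType} {d : nat}.

(* [P t eta] is the law at time t of the process started from eta. The set
   Omega0 consists of the initial configurations from which the process is
   well defined; the values of P outside Omega0 and at negative times carry no
   meaning. *)
Record is_particle_system (Omega0 : set (conf d))
    (P : R -> R.-pker (conf d) ~> (conf d)) : Prop := {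
  ps_measurable : measurable Omega0 ;
  ps_finite : @finite_conf d `<=` Omega0 ;
  ps_translate : forall z eta, Omega0 eta -> Omega0 (translate z eta) ;
  ps_start : forall eta A, Omega0 eta -> measurable A ->
    P 0 eta A = \d_eta A ;
  ps_invariant : forall t eta, 0 <= t -> Omega0 eta -> P t eta Omega0 = 1%E ;
  ps_semigroup : forall s t eta A, 0 <= s -> 0 <= t -> Omega0 eta ->
    measurable A ->
    P (s + t) eta A = (\int[P s eta]_(zeta in Omega0) P t zeta A)%E ;
  ps_translation : forall t z eta A, 0 <= t -> Omega0 eta -> measurable A ->
    P t (translate z eta) A = P t eta (translate z @^-1` A) ;
  ps_conservation : forall t xi, 0 <= t -> finite_conf xi ->
    P t xi [set xi' | finite_conf xi' /\ mass xi' = mass xi] = 1%E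
}.

Definition transition_probability (P : R -> R.-pker (conf d) ~> (conf d))
  (t : R) (xi xi' : conf d) : \bar R := P t xi [set xi'].

Definition homogeneous_product (nu : probability (conf d) R) : Prop :=
  exists m : probability nat R,
  forall (s : seq (site d)) (A : site d -> set nat), uniq s ->
    nu [set eta | forall x, x \in s -> A x (eta x)]
    = (\prod_(x <- s) m (A x))%E.

Definition stationary (Omega0 : set (conf d))
    (P : R -> R.-pker (conf d) ~> (conf d)) (nu : probability (conf d) R) :=
  nu Omega0 = 1%E /\
  forall t A, 0 <= t -> measurable A ->
    (\int[nu]_(eta in Omega0) P t eta A = nu A)%E.

Section process.
Context {dW : measure_display} {W : measurableType dW}.

Definition past (eta : R -> W -> conf d) (t : R) : set (set W) :=
  <<s [set A | exists u B,
        [/\ 0 <= u <= t, measurable B & A = eta u @^-1` B] ]>>.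

(* N carries the discrete topology, so a coordinate path is right-continuous
   with left limits iff it is constant just after every time and just before
   every positive time. *)
Definition cadlag (path : R -> conf d) : Prop :=
  forall x : site d,
    (forall t, 0 <= t -> \forall u \near t^'+, path u x = path t x) /\
    (forall t, 0 < t -> exists n, \forall u \near t^'-, path u x = n).

Record is_markov_process (Omega0 : set (conf d))
    (P : R -> R.-pker (conf d) ~> (conf d)) (nu : probability (conf d) R)
    (Pr : probability W R) (eta : R -> W -> conf d) : Prop := {
  mp_measurable : forall t, 0 <= t -> measurable_fun setT (eta t) ;
  mp_initial : forall A, measurable A -> Pr (eta 0 @^-1` A) = nu A ;
  mp_markov : forall s t A B, 0 <= s -> 0 <= t -> past eta s A ->
    measurable B ->
    Pr (A `&` eta (s + t) @^-1` B)
    = (\int[Pr]_(w in A `&` eta s @^-1` Omega0) P t (eta s w) B)%E ;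
  mp_cadlag : {ae Pr, forall w, cadlag (fun t => eta t w)}
}.

End process.

Section duality.
Local Open Scope ereal_scope.
Implicit Types (P : R -> R.-pker (conf d) ~> (conf d))
  (nu : probability (conf d) R) (D : conf d -> conf d -> R).

(* D xi is only meaningful for xi in finite_conf, a set that carries the
   whole mass of P t xi. *)
Definition self_duality (Omega0 : set (conf d)) P D : Prop :=
  forall (t : R) (xi eta : conf d), (0 <= t)%R -> finite_conf xi -> Omega0 eta ->
  [/\ (P t eta).-integrable setT (fun zeta => (D xi zeta)%:E),
      (P t xi).-integrable (@finite_conf d) (fun xi' => (D xi' eta)%:E) &
      \int[P t eta]_zeta (D xi zeta)%:E
      = \int[P t xi]_(xi' in @finite_conf d) (D xi' eta)%:E].

Definition factorized_polynomials D : Prop :=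
  exists d1 : nat -> nat -> R,
  [/\ forall xi eta, finite_conf xi ->
        D xi eta = \big[*%R/1%R]_(x \in [set: site d]) d1 (xi x) (eta x),
      forall n, d1 0%N n = 1%R &
      forall k, exists p : {poly R},
        size p = k.+1 /\ forall n, d1 k n = p.[n%:R]%R].

Definition orthogonal_polynomials nu D : Prop :=
  let a xi := 'N[nu]_2%:E[EFin \o D xi] ^+ 2 in
  (forall xi, finite_conf xi -> a xi < +oo) /\
  forall xi xi', finite_conf xi -> finite_conf xi' ->
    \int[nu]_eta (D xi eta * D xi' eta)%:E = (xi == xi')%:R%:E * a xi.

Record orthogonal_self_duality (Omega0 : set (conf d)) P nu D : Prop := {
  osd_duality : self_duality Omega0 P D ;
  osd_factorized : factorized_polynomials D ;
  osd_orthogonal : orthogonal_polynomials nu D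
}.

End duality.

(* Iterated partial derivative along the list of coordinates l. *)
Fixpoint partials (l : seq 'I_d) (f : 'rV[R]_d -> R) : 'rV[R]_d -> R :=
  if l is i :: l' then
    fun x => 'D_(delta_mx 0 i : 'rV[R]_d) (partials l' f) x
  else f.

Definition schwartz (f : 'rV[R]_d -> R) : Prop :=
  (forall l, continuous (partials l f) /\
     forall i x, derivable (partials l f) x (delta_mx 0 i : 'rV[R]_d)) /\
  forall (alpha : 'I_d -> nat) (l : seq 'I_d), exists M : R, forall x : 'rV[R]_d,
    `|(\prod_(i < d) x 0 i ^+ alpha i) * partials l f x| <= M.

(* Sum of an absolutely summable family (esum is meant for nonnegative terms
   only). *)
Definition lattice_sum (f : site d -> R) : R :=
  fine (\esum_(z in [set: site d]) (Num.max (f z) 0)%:E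
        - \esum_(z in [set: site d]) (Num.max (- f z) 0)%:E)%E.

(* For eta sampled from nu the family is almost surely absolutely summable,
   because phi decays rapidly and the L2 norm of D (conf_of (shift_points z x))
   does not depend on z. *)
Definition field_X (D : conf d -> conf d -> R) (N k : nat)
    (x : 'I_k -> site d) (eta : conf d) (phi : 'rV[R]_d -> R) : R :=
  lattice_sum (fun z => phi (\row_(i < d) ((z 0 i)%:~R / N%:R))
                        * D (conf_of (shift_points z x)) eta).

End particle_system.

(* Main.v *)
Require Import Defs.
From HB Require Import structures.
From mathcomp Require Import all_boot all_order all_algebra.
From mathcomp Require Import all_classical all_reals all_analysis.
From mathcomp Require Import measurable_realfun giry ring lra zify.
Set Implicit Arguments.
Unset Strict Implicit.
Unset Printing Implicit Defensive.
Import Order.TTheory GRing.Theory Num.Theory.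
Import numFieldNormedType.Exports.
Local Open Scope classical_set_scope.
Local Open Scope ring_scope.

(** Write [xi_z] for the configuration of the [k] points of [x] shifted by [z].
    Stationarity, the Markov property and self-duality turn the correlation of
    [D(xi_z, eta(t))] and [D(xi_w, eta(s))], [s <= t], into an average of one-time
    correlations under [nu], of which orthogonality keeps the single term
    [p_(t - s)(xi_z, xi_w) a(xi_w)] ([two_time_correlation]). The norms [a] are
    bounded on configurations of [k] particles ([second_moment_bounded]), and the
    lattice sums of a Schwartz function are of order [N ^ d]
    ([schwartz_lattice_sum]); hence the covariance of the field at time lag [r] is
    at most of order [N ^ d] times the supremum over [z] of
    [sum_w |phi(w / N)| p_r(xi_z, xi_w)] ([field_covariance_le]).

    It remains to find the decay of this sum in [r]. Multiplying the
    bound on [p_r] by the total weight, of order [N ^ d], is not enough when [d >= 3].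
    But self-duality with polynomials says more about the finite systems: they are
    consistent, i.e. the dynamics commutes with choosing [k] of the particles
    ([consistency]). Indeed expectations map polynomials of degree [k] in the
    occupation numbers to polynomials of degree at most [k]
    ([expect_site_product_diff]), the number of ways of choosing a given
    configuration of [k] particles is such a polynomial, and a polynomial of degree
    [k] that vanishes on fewer than [k] particles is determined by its values on
    [k] particles ([newton_top], from the expansion in finite differences).

    Consistency allows one to start from many copies of [xi_z] instead
    ([transition_le_expect]), and thus to bound [p_r(xi_z, xi_w)] by expected
    [k]-th powers of occupation numbers near [w]. Such a power is interpolated
    between the occupation number itself, whose sum over the lattice is the number
    of particles, and its [M]-th factorial moment ([exp_le_bin]), which consistency
    expresses through the [M]-particle kernel. Since [M] is arbitrary, the sum over
    [w] is at most of order [(N ^ a (1 + r) ^ (- b)) ^ (k - 1)] for every [a > 0] and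
    every [b] in [[0, d / 2]] ([return_decay]). Integrating in time with
    [b (k - 1) < 1] turns this into [N ^ ((k - 1) (a - 2 b))] ([time_integral_le]),
    and [decay_exponents] provides [a] and [b] for the stated exponent. *)

(** * Finite configurations *)

Section finite_configurations.
Variable d : nat.
Implicit Types (a x : site d) (s u y : seq (site d)) (xi eta : conf d).

(** Finite configurations are handled as lists of the positions of their particles,
    so that choosing particles becomes choosing a subsequence. *)
Definition conf_seq s : conf d := fun x => count_mem x s.

Definition add_particle a eta : conf d := fun x => ((a == x) + eta x)%N.

Definition sector (n : nat) : set (conf d) :=
  [set xi | finite_conf xi /\ mass xi = n].

Lemma conf_seq_finite s : finite_conf (conf_seq s).
Proof.
apply: (@sub_finite_set _ _ [set` s]); last exact: finite_seq.
by move=> x /= /eqP; rewrite -lt0n -has_count has_pred1.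
Qed.

Lemma mass_sum xi s : uniq s -> (forall x, x \notin s -> xi x = 0%N) ->
  mass xi = (\sum_(x <- s) xi x)%N.
Proof.
move=> us xis; rewrite /mass (@fsbigE _ _ _ _ _ s)//=; last by move=> x _; exact: xis.
by under eq_bigl => x do rewrite in_setT.
Qed.

Lemma mass_conf_seq s : mass (conf_seq s) = size s.
Proof.
rewrite (mass_sum (undup_uniq s)); last first.
  by move=> x; rewrite mem_undup /conf_seq => /count_memPn.
rewrite -[RHS](perm_size (perm_count_undup s)) size_flatten /shape -map_comp.
by rewrite sumnE big_map; apply: eq_bigr => x _ /=; rewrite size_nseq.
Qed.

Lemma finite_conf_seq xi : finite_conf xi ->
  exists2 s, conf_seq s = xi & size s = mass xi.
Proof.
move=> /finite_seqP[r0 er0]; pose r := undup r0.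
have rP x : x \notin r -> xi x = 0%N.
  rewrite mem_undup => /negP xr; apply: contrapT => /= xi0; apply: xr.
  by have : [set` r0] x by rewrite -er0.
have e : conf_seq (flatten [seq nseq (xi x) x | x <- r]) = xi.
  apply/funext => y; rewrite /conf_seq count_flatten -map_comp sumnE big_map.
  under eq_bigr => x _ do rewrite /= count_nseq /=.
  have [yr|yr] := boolP (y \in r).
    rewrite (bigD1_seq y)//= ?undup_uniq// eqxx mul1n big1 ?addn0// => x /negPf->.
    by [].
  rewrite rP// big1_seq// => x /= xr; case: eqVneq => // xy.
  by move: yr; rewrite -xy xr.
exists (flatten [seq nseq (xi x) x | x <- r]) => //.
by rewrite -mass_conf_seq e.
Qed.

Lemma sectorP n xi : sector n xi <-> exists2 s, conf_seq s = xi & size s = n.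
Proof.
split => [[/finite_conf_seq[s <- <-] <-]|[s <- <-]].
  by exists s => //; rewrite mass_conf_seq.
by split; [exact: conf_seq_finite|exact: mass_conf_seq].
Qed.

Lemma sector_countable n : countable (sector n).
Proof.
rewrite (_ : sector n = \bigcup_(s in [set s : seq (site d) | size s = n])
  [set conf_seq s]); first exact: bigcup_countable.
apply/seteqP; split => xi; first by move=> /sectorP[s <- sn]; exists s.
by move=> [s sn ->]; apply/sectorP; exists s.
Qed.

Lemma le_mass xi x : finite_conf xi -> (xi x <= mass xi)%N.
Proof.
by move=> /finite_conf_seq[s <-] <-; exact: count_size.
Qed.

Lemma undup_nseq n (a : site d) : (0 < n)%N -> undup (nseq n a) = [:: a].
Proof.
case: n => // n _; elim: n => // n ih.
by rewrite [nseq _ _]/= [undup _]/= inE eqxx; exact: ih.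
Qed.

End finite_configurations.

Lemma normM_le_sqrD (R : realDomainType) (a b : R) : `|a * b| <= a ^+ 2 + b ^+ 2.
Proof.
rewrite normrM -(real_normK (num_real a)) -(real_normK (num_real b)).
by have := sqr_ge0 (`|a| - `|b|); have := normr_ge0 a; have := normr_ge0 b; nra.
Qed.

(** * Finite differences of functions of a configuration *)

Section differences.
Context {R : pzRingType} {d : nat}.
Implicit Types (g f : conf d -> R) (a x : site d) (s u y : seq (site d)).

Definition fdiff1 a g : conf d -> R := fun eta => g (add_particle a eta) - g eta.

Fixpoint fdiff s g : conf d -> R :=
  if s is a :: s' then fdiff s' (fdiff1 a g) else g.

(** With multiplicity: a subsequence occurs once for every set of positions from
    which it can be read, as for labelled particles. *)
Fixpoint subseqs s : seq (seq (site d)) :=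
  if s is a :: s' then subseqs s' ++ [seq a :: u | u <- subseqs s'] else [:: [::]].

Lemma fdiff_lin s (c : R) f g eta :
  fdiff s (fun zeta => f zeta + c * g zeta) eta = fdiff s f eta + c * fdiff s g eta.
Proof.
elim: s f g => //= a s ih f g; rewrite -ih; congr (fdiff s _ eta).
by apply/funext => z; rewrite /fdiff1 mulrBr opprD addrACA.
Qed.

Lemma fdiff0 s eta : fdiff s (fun=> 0) eta = 0.
Proof.
elim: s => //= a s <-; congr (fdiff s _ eta).
by apply/funext => z; rewrite /fdiff1 subrr.
Qed.

(** Adding a particle at [a] is the operator [1 + fdiff1 a]; the product of these
    operators over [y] is expanded. *)
Lemma newton_expansion y g eta :
  g (foldr (@add_particle d) eta y) = \sum_(s <- subseqs y) fdiff s g eta.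
Proof.
elim: y g => [|a y ih] g /=; first by rewrite big_seq1.
rewrite -[LHS]/((fun zeta => g (add_particle a zeta)) _) ih.
rewrite big_cat/= big_map -big_split/=; apply: eq_bigr => s _.
rewrite -[X in _ + X]mul1r -fdiff_lin; congr (fdiff s _ eta); apply/funext => z.
by rewrite mul1r /fdiff1 addrC subrK.
Qed.

Lemma conf_seqE s : conf_seq s = foldr (@add_particle d) (conf_seq [::]) s.
Proof. by elim: s => //= a s <-. Qed.

(** The difference of order [size s] at the empty configuration is an alternating
    sum of the values of [g] at the subconfigurations of [s], of which only [s]
    itself has as many particles. *)
Lemma fdiff_vanish (k : nat) s g : (forall u, (size u < k)%N -> g (conf_seq u) = 0) ->
  ((size s < k)%N -> fdiff s g (conf_seq [::]) = 0) /\
  (size s = k -> fdiff s g (conf_seq [::]) = g (conf_seq s)).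
Proof.
elim: s k g => [|a s ih] [|k] g g0 //=; first by split=> // _; exact: g0.
have e u : (size u <= k)%N -> fdiff1 a g (conf_seq u) = g (conf_seq (a :: u)).
  by move=> uk; rewrite /fdiff1 (g0 u)// subr0.
have [|ih1 ih2] := ih k (fdiff1 a g).
  by move=> u uk; rewrite e ?(ltnW uk)// g0.
split=> [|[sk]]; first exact: ih1.
by rewrite ih2// e ?sk.
Qed.

(** In the Newton expansion at the empty configuration, the orders below [k] vanish
    because [g] does, the orders above [k] because [g] has degree at most [k], and
    the terms of order [k] are values of [g]. *)
Lemma newton_top (k : nat) y g :
  (forall u, (size u < k)%N -> g (conf_seq u) = 0) ->
  (forall s, (k < size s)%N -> fdiff s g (conf_seq [::]) = 0) ->
  g (conf_seq y) = \sum_(s <- subseqs y | size s == k) g (conf_seq s).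
Proof.
move=> g0 dg; rewrite conf_seqE newton_expansion (bigID (fun s => size s == k))/=.
rewrite [X in _ + X]big1 ?addr0; last first.
  move=> s; rewrite neq_ltn => /orP[sk|]; last exact: dg.
  by have [->] := fdiff_vanish s g0.
by apply: eq_bigr => s /eqP sk; have [_ ->] := fdiff_vanish s g0.
Qed.

End differences.

Section subsequences.
Context {d : nat}.
Implicit Types (a x : site d) (s u y : seq (site d)).

Lemma count_subseqs_size y n :
  count (fun s => size s == n) (subseqs y) = 'C(size y, n).
Proof.
elim: y n => [|a y ih] [|n] //=; rewrite count_cat count_map ih.
  by rewrite ?bin0 (@eq_count _ _ pred0) ?count_pred0// ?addn0.
by rewrite binS; congr addn; rewrite -ih; apply: eq_count.
Qed.

(** Choosing one element in each group of copies yields [s]. *)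
Lemma count_subseqs_copies n s :
  (n ^ size s <= count_mem s (subseqs (flatten [seq nseq n x | x <- s])))%N.
Proof.
elim: s => //= a s ih; set t := flatten _.
suff H m : (m * n ^ size s <= count_mem (a :: s) (subseqs (nseq m a ++ t)))%N.
  by rewrite expnS; exact: H.
elim: m => // m ihm /=; rewrite count_cat count_map mulSn addnC leq_add//.
apply: leq_trans ih _.
rewrite (@eq_count _ (preim _ _) (pred1 s)); last first.
  by move=> u /=; rewrite eqseq_cons eqxx.
by elim: m {ihm} => //= m /leq_trans->//; rewrite count_cat leq_addr.
Qed.

End subsequences.

(** * Polynomials in the occupation numbers *)

Section product_polynomials.
Context {R : realType} {d : nat}.
Implicit Types (a x : site d) (s y : seq (site d)) (h : site d -> {poly R}).

Definition site_product s h : conf d -> R :=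
  fun eta => \prod_(x <- s) (h x).[(eta x)%:R].

Lemma size_poly_shift_sub (p : {poly R}) (n : nat) : (size p <= n.+1)%N ->
  (size (p \Po ('X + 1%:P) - p)%R <= n)%N.
Proof.
elim/poly_ind: p n => [|p c ih] n; first by rewrite comp_poly0 subr0 size_poly0.
have [->|p0] := eqVneq p 0.
  by rewrite mul0r add0r comp_polyC subrr size_poly0.
rewrite size_MXaddC (negPf p0)/= ltnS => pn.
have -> : (p * 'X + c%:P) \Po ('X + 1%:P) - (p * 'X + c%:P) =
  (p \Po ('X + 1%:P) - p) * 'X + (p \Po ('X + 1%:P)).
  by rewrite comp_polyD comp_polyM comp_polyX comp_polyC; ring.
case: n pn => [|n] pn; first by move: pn; rewrite leqn0 size_poly_eq0 (negPf p0).
apply: leq_trans (size_polyD _ _) _; rewrite geq_max; apply/andP; split.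
  apply: leq_trans (size_polyMleq _ _) _; rewrite size_polyX addn2/= ltnS.
  exact: ih.
by rewrite size_comp_poly2// size_XaddC.
Qed.

Lemma fdiff1_site_product a s h : uniq s -> a \in s ->
  fdiff1 a (site_product s h) =
  site_product s (fun x => if x == a then h a \Po ('X + 1%:P) - h a else h x).
Proof.
move=> us sa; apply/funext => eta; rewrite /fdiff1 /site_product.
rewrite !(bigD1_seq a)//= eqxx /add_particle eqxx.
rewrite hornerD hornerN horner_comp !hornerE [RHS]mulrBl natrD [1 + _]addrC.
by congr (_ * _ - _ * _); apply: eq_bigr => x xa; rewrite (negPf xa) // [a == x]eq_sym (negPf xa).
Qed.

(** A difference at a site of [s] lowers the degree of one factor by one, and a
    difference at any other site is zero. *)
Lemma fdiff_site_product (j : site d -> nat) (k : nat) s y h eta : uniq s ->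
  (forall x, (size (h x) <= (j x).+1)%N) -> (\sum_(x <- s) j x <= k)%N ->
  (k < size y)%N -> fdiff y (site_product s h) eta = 0.
Proof.
move=> us; elim: y j k h => // a y ih j k h hj jk; rewrite /= ltnS => ky.
have [as_|as_] := boolP (a \in s); last first.
  rewrite (_ : fdiff1 a _ = fun=> 0) ?fdiff0//; apply/funext => z.
  rewrite /fdiff1 /site_product; apply/eqP; rewrite subr_eq0; apply/eqP.
  apply: eq_big_seq => x xs; rewrite /add_particle; case: eqVneq => // ax.
  by move: as_; rewrite ax xs.
rewrite fdiff1_site_product//.
have [ja|ja] := posnP (j a).
  rewrite (_ : site_product _ _ = fun=> 0) ?fdiff0//; apply/funext => z.
  apply/eqP; rewrite /site_product prodf_seq_eq0; apply/hasP; exists a => //=.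
  have := size_poly_shift_sub (hj a); rewrite ja leqn0 size_poly_eq0 eqxx => /eqP->.
  by rewrite horner0.
move: (jk); rewrite (bigD1_seq a)//= => jk'.
apply: (ih (fun x => if x == a then (j a).-1 else j x) k.-1).
- move=> x; case: eqVneq => [_|_]; last exact: hj.
  by rewrite prednK//; exact: size_poly_shift_sub.
- rewrite (bigD1_seq a)//= eqxx.
  rewrite [X in (_ + X)%N](_ : _ = \sum_(i <- s | i != a) j i)%N; first by lia.
  by apply: eq_bigr => x /negPf->.
- by lia.
Qed.

End product_polynomials.

(** * Measures of total mass one *)

Section full_sets.
Context {dT : measure_display} {T : measurableType dT} {R : realType}.
Variables (mu : {measure set T -> \bar R}) (A : set T).
Hypotheses (mA : measurable A) (muT : mu setT = 1%E) (muA : mu A = 1%E).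

Lemma full_ae : {ae mu, forall x, A x}.
Proof.
exists (~` A); split => //; first exact: measurableC.
have : (mu setT = mu A + mu (~` A))%E.
  by rewrite -(setUv A) measureU//; [exact: measurableC|exact: setICr].
rewrite muT muA; case: (mu (~` A)) => [r [/eqP]||]//.
by rewrite -{1}[1]addr0 (inj_eq (addrI _)) => /eqP <-.
Qed.

Lemma ae_full_integral (f g : T -> \bar R) :
  measurable_fun setT f -> measurable_fun setT g -> {in A, f =1 g} ->
  (\int[mu]_x f x = \int[mu]_x g x)%E.
Proof.
move=> mf mg fg; apply: ae_eq_integral => //.
by apply: filterS full_ae => x Ax _; apply: fg; rewrite inE.
Qed.

Lemma full_le_integral (f g : T -> \bar R) :
  measurable_fun setT f -> measurable_fun setT g ->
  (forall x, 0 <= f x)%E -> (forall x, 0 <= g x)%E ->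
  (forall x, A x -> f x <= g x)%E ->
  (\int[mu]_x f x <= \int[mu]_x g x)%E.
Proof.
move=> mf mg f0 g0 fg; apply: ae_ge0_le_integral => //.
by apply: filterS full_ae => x Ax _; exact: fg.
Qed.

Lemma bounded_full_integrable (f : T -> R) (B : R) : measurable_fun setT f ->
  (forall x, A x -> `|f x| <= B) -> mu.-integrable setT (EFin \o f).
Proof.
move=> mf fB; apply/integrableP; split; first exact/measurable_EFinP.
apply: (@le_lt_trans _ _ (\int[mu]_x (Num.max B 0)%:E)%E); last first.
  by rewrite integral_cst// muT mule1 ltry.
apply: full_le_integral => //.
- by apply: measurableT_comp => //; exact/measurable_EFinP.
- by move=> x; rewrite lee_fin le_max lexx orbT.
- by move=> x /fB fxB; rewrite /= lee_fin le_max fxB.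
Qed.

End full_sets.

(** * Measurability on the configuration space *)

Section configuration_measurability.
Context {R : realType} {d : nat}.
Implicit Types (x : site d) (xi : conf d).

Lemma measurable_occupation x : measurable_fun setT (fun eta : conf d => eta x).
Proof.
move=> _ B _; rewrite setTI (_ : _ @^-1` _ =
  \bigcup_(n in B) [set eta : conf d | eta x = n]).
  by apply: bigcup_measurable => n _; apply: sub_sigma_algebra; exists x, n.
by apply/seteqP; split => eta /=; [move=> Be; exists (eta x)|move=> [n Bn ->]].
Qed.

Lemma measurable_occupation_fun x (f : nat -> R) :
  measurable_fun setT (fun eta : conf d => f (eta x)).
Proof. by apply: (measurableT_comp (f := f)) => //; exact: measurable_occupation. Qed.

Lemma measurable_prod_occupation (s : seq (site d)) (f : site d -> nat -> R) :
  measurable_fun setT (fun eta : conf d => \prod_(x <- s) f x (eta x)).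
Proof.
apply: measurable_prod => x _; exact: (measurable_occupation_fun x (f x)).
Qed.

(** A configuration is determined by its values at countably many sites. *)
Lemma measurable_conf1 xi : measurable [set xi].
Proof.
rewrite (_ : [set xi] = ~` \bigcup_x (~` [set eta : conf d | eta x = xi x])).
  apply/measurableC/countable_bigcupT_measurable => // x.
  by apply: measurableC; apply: sub_sigma_algebra; exists x, (xi x).
rewrite setC_bigcup; apply/seteqP; split => [eta -> x _ /=|eta h]; first exact.
by apply/funext => x; have := h x Logic.I => /= /contrapT.
Qed.

Lemma measurable_countable_confs (A : set (conf d)) : countable A -> measurable A.
Proof. by move=> cA; apply: countable_measurable => // xi; exact: measurable_conf1. Qed.

Lemma measurable_sector n : measurable (@sector d n).
Proof. by apply: measurable_countable_confs; exact: sector_countable. Qed.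

Lemma finite_confE : @finite_conf d = \bigcup_n sector n.
Proof.
apply/seteqP; split => [xi fxi|xi [n _ []]//]; by exists (mass xi).
Qed.

Lemma measurable_finite_conf : measurable (@finite_conf d).
Proof. by rewrite finite_confE; apply: bigcup_measurable => n _; exact: measurable_sector. Qed.

Lemma measurable_site_product (s : seq (site d)) (h : site d -> {poly R}) :
  measurable_fun setT (site_product s h).
Proof. exact: (measurable_prod_occupation s (fun x n => (h x).[n%:R])). Qed.

End configuration_measurability.

(** * Choosing particles in a configuration *)

Section choose_functions.
Context {R : realType} {d : nat}.
Implicit Types (x : site d) (s u : seq (site d)).

Lemma binomial_poly (j : nat) : exists p : {poly R},
  (size p <= j.+1)%N /\ forall n, p.[n%:R] = 'C(n, j)%:R.
Proof.
exists (j`!%:R^-1 *: \prod_(0 <= i < j) ('X - i%:R%:P)); split.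
  by rewrite (leq_trans (size_scale_leq _ _))// size_prod_XsubC size_iota subn0.
move=> n; have fj : j`!%:R != 0 :> R by rewrite pnatr_eq0 -lt0n fact_gt0.
rewrite hornerZ horner_prod big_mkord; apply: (mulfI fj); rewrite mulVKf//.
under eq_bigr => i _ do rewrite hornerXsubC.
rewrite -natrM mulnC bin_ffact; have [nj|jn] := ltnP n j.
  by rewrite ffact_small// (bigD1 (Ordinal nj))//= subrr mul0r.
rewrite ffact_prod natr_prod; apply: eq_bigr => i _.
by rewrite natrB// ltnW// (leq_trans (ltn_ord i)).
Qed.

(** The number of ways of choosing the particles of [conf_seq s] in [zeta]. *)
Definition choose_conf s (zeta : conf d) : R :=
  \prod_(x <- undup s) 'C(zeta x, count_mem x s)%:R.

Lemma choose_conf_neq0 s u : (size u <= size s)%N ->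
  choose_conf s (conf_seq u) != 0 -> conf_seq u = conf_seq s.
Proof.
move=> us; rewrite /choose_conf prodf_seq_neq0 => /allP h.
have /count_subseqP[s' s'u ps'] : forall x, (count_mem x s <= count_mem x u)%N.
  move=> x; have [xs|/count_memPn->//] := boolP (x \in s).
  have /= := h x; rewrite mem_undup => /(_ xs).
  by rewrite pnatr_eq0 -lt0n bin_gt0.
have e : s' = u.
  apply/eqP; rewrite -(size_subseq_leqif s'u) eqn_leq (size_subseq s'u)/=.
  by rewrite -(perm_size ps').
by apply/funext => x; rewrite /conf_seq -e; apply/esym/permP.
Qed.

Lemma choose_conf_self s : choose_conf s (conf_seq s) = 1.
Proof. by rewrite /choose_conf big1// => x _; rewrite binn. Qed.

Lemma choose_conf_sector s zeta : sector (size s) zeta ->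
  choose_conf s zeta = \1_[set conf_seq s] zeta.
Proof.
move=> /sectorP[u <- us]; rewrite indicE.
have [e|ne] := eqVneq (choose_conf s (conf_seq u)) 0.
  rewrite e; case: (boolP (_ \in _)) => //; rewrite inE/= => eu.
  by move: e; rewrite eu choose_conf_self => /eqP; rewrite oner_eq0.
move: (ne) => /choose_conf_neq0 -> //; last by rewrite us.
by rewrite choose_conf_self mem_set.
Qed.

Lemma choose_conf_small s zeta m : (m < size s)%N -> sector m zeta ->
  choose_conf s zeta = 0.
Proof.
move=> ms /sectorP[u <- um]; have [//|] := eqVneq (choose_conf s (conf_seq u)) 0.
rewrite -um in ms *; move=> /(choose_conf_neq0 (ltnW ms)) /(congr1 (@mass d)).
by rewrite !mass_conf_seq => e; rewrite e ltnn in ms.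
Qed.

Lemma site_product_bounded s h n : exists B : R, forall zeta : conf d,
  sector n zeta -> `|site_product s h zeta| <= B.
Proof.
exists (\prod_(x <- s) \sum_(i < n.+1) `|(h x).[i%:R]|) => zeta [fz mz].
rewrite normr_prod; apply: ler_prod => x _; rewrite normr_ge0/=.
have zn : (zeta x < n.+1)%N by rewrite ltnS -mz le_mass.
by rewrite (bigD1 (Ordinal zn))//= lerDl sumr_ge0.
Qed.

Lemma choose_conf_site_product s : exists h : site d -> {poly R},
  (forall x, (size (h x) <= (count_mem x s).+1)%N) /\
  choose_conf s = site_product (undup s) h.
Proof.
have [b hb] := choice binomial_poly.
exists (fun x => b (count_mem x s)); split=> [x|]; first by have [] := hb (count_mem x s).
apply/funext => zeta; apply: eq_bigr => x _; by have [_ ->] := hb (count_mem x s).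
Qed.

Lemma measurable_choose_conf s : measurable_fun setT (choose_conf s).
Proof. exact: (measurable_prod_occupation _ (fun x n => 'C(n, count_mem x s)%:R)). Qed.

Lemma choose_conf_bounded s n : exists B : R, forall zeta : conf d,
  sector n zeta -> `|choose_conf s zeta| <= B.
Proof. have [h [_ ->]] := choose_conf_site_product s; exact: site_product_bounded. Qed.

Lemma sum_count_mem_undup s : (\sum_(x <- undup s) count_mem x s)%N = size s.
Proof.
rewrite -[RHS]mass_conf_seq (mass_sum (undup_uniq s))// => x.
by rewrite mem_undup /conf_seq => /count_memPn.
Qed.

End choose_functions.

(** * Consistency of the particle system *)

Lemma fdiff_ext (R : pzRingType) d s (f g : conf d -> R) u :
  (forall v, f (conf_seq v) = g (conf_seq v)) ->
  fdiff s f (conf_seq u) = fdiff s g (conf_seq u).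
Proof.
elim: s f g => //= a s ih f g fg; apply: ih => v.
by rewrite /fdiff1 !fg -[add_particle a _]/(conf_seq (a :: v)) fg.
Qed.

Lemma fdiff_integral (R : realType) d (mu : {measure set (conf d) -> \bar R}) A
  (G : conf d -> conf d -> R) s u : measurable A ->
  (forall v, mu.-integrable A (fun xi => (G xi (conf_seq v))%:E)) ->
  mu.-integrable A (fun xi => (fdiff s (G xi) (conf_seq u))%:E) /\
  fdiff s (fun eta => fine (\int[mu]_(xi in A) (G xi eta)%:E)%E) (conf_seq u)
  = fine (\int[mu]_(xi in A) (fdiff s (G xi) (conf_seq u))%:E)%E.
Proof.
move=> mA; elim: s G => //= a s ih G iG.
have iG1 v : mu.-integrable A (fun xi => (fdiff1 a (G xi) (conf_seq v))%:E).
  exact: (integrableB mA (iG (a :: v)) (iG v)).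
have [h1 h2] := ih (fun xi => fdiff1 a (G xi)) iG1.
split=> //; rewrite -h2; apply: fdiff_ext => v; rewrite /fdiff1.
rewrite -fineB ?(integrable_fin_num mA (iG v)) ?(integrable_fin_num mA (iG (a :: v)))//.
by rewrite -(integralB mA (iG (a :: v)) (iG v)).
Qed.

(** The number of particles is conserved, so boundedness on every sector suffices
    for expectations from finite configurations. *)
Definition tame (R : realType) d (g : conf d -> R) := measurable_fun setT g /\
  forall n, exists B : R, forall zeta, sector n zeta -> `|g zeta| <= B.

Definition expect (R : realType) d (P : R -> R.-pker (conf d) ~> (conf d)) (t : R)
  (g : conf d -> R) (eta : conf d) : R := fine (\int[P t eta]_zeta (g zeta)%:E)%E.

Section tame_functions.
Context {R : realType} {d : nat}.

Lemma tame_site_product s h : tame (@site_product R d s h).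
Proof.
by split; [exact: measurable_site_product|exact: site_product_bounded].
Qed.

Lemma tame_choose_conf s : tame (@choose_conf R d s).
Proof.
by split; [exact: measurable_choose_conf|exact: choose_conf_bounded].
Qed.

Lemma tame0 : tame (fun _ : conf d => 0 : R).
Proof.
by split; [exact: measurable_cst|move=> n; exists 0 => z _; rewrite normr0].
Qed.

Lemma tameD (f g : conf d -> R) (c : R) : tame f -> tame g ->
  tame (fun zeta => f zeta + c * g zeta).
Proof.
move=> [mf bf] [mg bg]; split.
  by apply: measurable_funD => //; apply: measurable_funM.
move=> n; have [B hB] := bf n; have [B' hB'] := bg n.
exists (B + `|c| * B') => z sz; rewrite (le_trans (ler_normD _ _))// lerD ?hB//.
by rewrite normrM ler_wpM2l// hB'.
Qed.

Lemma tame_sum (I : eqType) (r : seq I) (c : I -> R) (f : I -> conf d -> R) :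
  (forall i, tame (f i)) -> tame (fun zeta => \sum_(i <- r) c i * f i zeta).
Proof.
move=> tf; elim: r => [|i r ih].
  by under eq_fun => z do rewrite big_nil; exact: tame0.
by under eq_fun => z do rewrite big_cons addrC; exact: tameD.
Qed.

Lemma tame_occupation (f : nat -> R) a : tame (fun zeta : conf d => f (zeta a)).
Proof.
split; first exact: (measurable_occupation_fun a f).
move=> n; exists (\sum_(i < n.+1) `|f i|) => zeta [fz mz].
have zn : (zeta a < n.+1)%N by rewrite ltnS -mz le_mass.
by rewrite (bigD1 (Ordinal zn))//= lerDl sumr_ge0.
Qed.

End tame_functions.

Section consistency.
Context {R : realType} {d : nat} {Omega0 : set (conf d)}
  {P : R -> R.-pker (conf d) ~> (conf d)} {D : conf d -> conf d -> R}.
Hypothesis systemP : is_particle_system Omega0 P.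
Hypothesis D_duality : self_duality Omega0 P D.
Hypothesis D_factor : factorized_polynomials D.
Implicit Types (x : site d) (s u y : seq (site d)).

Lemma duality_site_product : exists p : nat -> {poly R},
  (forall k, size (p k) = k.+1) /\
  forall s xi, uniq s -> (forall x, x \notin s -> xi x = 0%N) ->
    D xi = site_product s (fun x => p (xi x)).
Proof.
have [d1 [DE d10 dp]] := D_factor; have [p pP] := choice dp.
exists p; split=> [k|s xi us xis]; first by have [] := pP k.
have fxi : finite_conf xi.
  apply: (@sub_finite_set _ _ [set` s]); last exact: finite_seq.
  by move=> x /= /eqP; apply: contraNT => /xis ->.
apply/funext => eta; rewrite DE// (@fsbigE _ _ _ _ _ s)//=; last first.
  by move=> x _ /xis ->.
under eq_bigl => x do rewrite in_setT.
by apply: eq_bigr => x _; have [_ ->] := pP (xi x).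
Qed.

Variables (t : R) (t_ge0 : 0 <= t).

Lemma sector_full s : P t (conf_seq s) (sector (size s)) = 1%E.
Proof.
have := ps_conservation systemP t_ge0 (conf_seq_finite s).
by rewrite mass_conf_seq.
Qed.

Local Notation St := (expect P t).

Lemma tame_integrable g s : tame g -> (P t (conf_seq s)).-integrable setT (EFin \o g).
Proof.
move=> [mg /(_ (size s))[B gB]].
apply: (bounded_full_integrable (measurable_sector _) _ (sector_full s) mg gB).
exact: prob_kernel.
Qed.

Lemma expect_lin (c : R) f g s : tame f -> tame g ->
  St (fun zeta => f zeta + c * g zeta) (conf_seq s) =
  St f (conf_seq s) + c * St g (conf_seq s).
Proof.
move=> /(tame_integrable s) tf /(tame_integrable s) tg; rewrite /expect.
under eq_integral => z _ do rewrite EFinD EFinM.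
rewrite (integralD measurableT tf (integrableZl measurableT c tg)).
rewrite (integralZl measurableT tg) fineD ?fineM//.
- exact: integrable_fin_num.
- exact: integrable_fin_num.
- by rewrite fin_numM// integrable_fin_num.
Qed.

Lemma expect_sector f g s : tame f -> tame g ->
  (forall zeta, sector (size s) zeta -> f zeta = g zeta) ->
  St f (conf_seq s) = St g (conf_seq s).
Proof.
move=> [mf _] [mg _] fg; congr fine.
apply: (ae_full_integral (measurable_sector (size s)) _ (sector_full s)).
- exact: prob_kernel.
- exact/measurable_EFinP.
- exact/measurable_EFinP.
- by move=> z; rewrite inE => /fg ->.
Qed.

Lemma expect0 s : St (fun=> 0) (conf_seq s) = 0.
Proof. by rewrite /expect integral0. Qed.

Lemma expect_sum (I : eqType) (r : seq I) (c : I -> R) (f : I -> conf d -> R) s :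
  (forall i, tame (f i)) ->
  St (fun zeta => \sum_(i <- r) c i * f i zeta) (conf_seq s) =
  \sum_(i <- r) c i * St (f i) (conf_seq s).
Proof.
move=> tf; elim: r => [|i r ih].
  rewrite big_nil -[RHS](expect0 s); congr expect; apply/funext => z.
  by rewrite big_nil.
rewrite big_cons addrC -ih -expect_lin//; last exact: tame_sum.
by congr expect; apply/funext => z; rewrite big_cons addrC.
Qed.

Lemma expect_le f g s : tame f -> tame g ->
  (forall zeta, sector (size s) zeta -> f zeta <= g zeta) ->
  St f (conf_seq s) <= St g (conf_seq s).
Proof.
move=> tf tg fg; rewrite -subr_ge0.
have e : St (fun z => g z + (-1) * f z) (conf_seq s) =
    St g (conf_seq s) + (-1) * St f (conf_seq s) by exact: expect_lin.
rewrite mulN1r in e; rewrite -e.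
rewrite (@expect_sector _ (fun z => Num.max (g z + (-1) * f z) 0)).
- by apply/fine_ge0/integral_ge0 => z _; rewrite lee_fin le_max lexx orbT.
- exact: tameD.
- have [mh bh] := tameD (-1) tg tf; split.
    by apply: measurable_maxr => //; exact: measurable_cst.
  move=> n; have [B hB] := bh n; exists (Num.max B 0) => z /hB.
  by case: (leP _ 0) => [_ _|h0]; rewrite ?normr0 le_max ?lexx ?orbT// => ->.
- by move=> z sz; rewrite max_l// mulN1r subr_ge0 fg.
Qed.

Lemma expect_cst (c : R) s : St (fun=> c) (conf_seq s) = c.
Proof.
by rewrite /expect integral_cst//= prob_kernel mule1.
Qed.

(** By self-duality the expectation is an average of [D xi'] over [xi'] with as many
    particles as [xi], and each [D xi'] is a polynomial of degree [mass xi]. *)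
Lemma expect_duality_diff xi y : finite_conf xi -> (mass xi < size y)%N ->
  fdiff y (fun eta => fine (\int[P t eta]_zeta (D xi zeta)%:E)%E) (conf_seq [::]) = 0.
Proof.
move=> fxi xiy; have [p [sp DE]] := duality_site_product.
have dual v := D_duality t_ge0 fxi (ps_finite systemP (conf_seq_finite v)).
rewrite (@fdiff_ext _ _ _ _ (fun eta =>
  fine (\int[P t xi]_(xi' in @finite_conf d) (D xi' eta)%:E)%E)); last first.
  by move=> v; have [_ _ ->] := dual v.
have iD v : (P t xi).-integrable (@finite_conf d) (fun xi' => (D xi' (conf_seq v))%:E).
  by have [_ + _] := dual v.
have [iDy ->] := fdiff_integral y [::] measurable_finite_conf iD.
rewrite integral_mkcond.
have full : P t xi (sector (mass xi)) = 1%E.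
  by have := ps_conservation systemP t_ge0 fxi.
rewrite (@ae_full_integral _ _ _ _ _ (measurable_sector _) (prob_kernel _) full
  _ (cst 0%E)).
- by rewrite integral0.
- apply: (measurable_int (P t xi)).
  have iDy' := iDy; rewrite (integrable_mkcond _ measurable_finite_conf) in iDy'.
  exact: iDy'.
- exact: measurable_cst.
- move=> xi'; rewrite inE => sxi'; rewrite patchE mem_set; last by case: sxi'.
  move: sxi' => /sectorP[u <- um]; rewrite (DE (undup u)) ?undup_uniq//; last first.
    by move=> x; rewrite mem_undup => /count_memPn.
  rewrite (@fdiff_site_product _ _ (fun x => count_mem x u) (size u)) ?undup_uniq//.
  + by move=> x; rewrite sp.
  + by rewrite sum_count_mem_undup.
  + by rewrite um.
Qed.

(** The dynamics does not raise the degree of a polynomial. Factor by factor, [h x]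
    is a multiple of the duality polynomial of degree [j x] plus a remainder of
    lower degree, to which the induction on [k] applies; once all the factors are
    duality polynomials, the product is some [D xi] and self-duality concludes. *)
Lemma expect_site_product_diff k (j : site d -> nat) s (h : site d -> {poly R}) y : uniq s ->
  (forall x, (size (h x) <= (j x).+1)%N) -> (\sum_(x <- s) j x <= k)%N ->
  (k < size y)%N -> fdiff y (St (site_product s h)) (conf_seq [::]) = 0.
Proof.
have [p [sp DE]] := duality_site_product.
elim/ltn_ind: k j s h y => k ihk j s h y us hj jk ky.
(* r lists the sites whose factor is still to be replaced *)
pose hp (r : seq (site d)) (h : site d -> {poly R}) :=
  forall x, x \in s -> x \notin r -> h x = p (j x).
suff Q (r : seq (site d)) : forall h : site d -> {poly R},
    (forall x, (size (h x) <= (j x).+1)%N) -> hp r h ->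
    fdiff y (St (site_product s h)) (conf_seq [::]) = 0.
  by apply: (Q s h hj) => x ->.
elim: r => [|a r ihr] {hj}h hj hr.
  pose xi : conf d := fun x => if x \in s then j x else 0%N.
  have xis x : x \notin s -> xi x = 0%N by rewrite /xi => /negPf ->.
  have -> : site_product s h = D xi.
    rewrite (DE s)//; apply/funext => z; apply: eq_big_seq => x xs.
    by rewrite hr// /xi xs.
  have mxi : (mass xi <= k)%N.
    rewrite (mass_sum us xis); apply: leq_trans jk.
    by rewrite big_seq [leqRHS]big_seq; apply: leq_sum => x xs; rewrite /xi xs.
  apply: expect_duality_diff; last exact: leq_ltn_trans ky.
  apply: (@sub_finite_set _ _ [set` s]); last exact: finite_seq.
  by move=> x /= /eqP; apply: contraNT => /xis ->.
have [as_|as_] := boolP (a \in s); last first.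
  apply: ihr => // x xs xr; apply: hr => //; rewrite inE negb_or xr andbT.
  by apply: contraNneq as_ => <-.
pose c := (h a)`_(j a) / lead_coef (p (j a)); pose q := h a - c *: p (j a).
have lp : lead_coef (p (j a)) != 0.
  by rewrite lead_coef_eq0 -size_poly_eq0 sp.
have sq : (size q <= j a)%N.
  apply/leq_sizeP => i; rewrite leq_eqVlt => /predU1P[<-|ji].
    rewrite coefB coefZ (_ : (p (j a))`_(j a) = lead_coef (p (j a))).
      by rewrite /c divfK// subrr.
    by rewrite lead_coefE sp.
  by rewrite coefB coefZ !nth_default ?mulr0 ?subr0// ?sp// (leq_trans (hj a)).
pose h1 x := if x == a then p (j a) else h x.
pose h2 x := if x == a then q else h x.
have hE : site_product s h = fun z => site_product s h2 z + c * site_product s h1 z.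
  apply/funext => z; rewrite /site_product !(bigD1_seq a)//= /h1 /h2 eqxx.
  have e (g : {poly R}) : \prod_(i <- s | i != a) (if i == a then g else h i).[(z i)%:R]
      = \prod_(i <- s | i != a) (h i).[(z i)%:R].
    by apply: eq_bigr => i /negPf ->.
  by rewrite !e mulrA -mulrDl /q hornerD hornerN hornerZ subrK.
rewrite hE (@fdiff_ext _ _ _ _ (fun eta => St (site_product s h2) eta +
  c * St (site_product s h1) eta)); last first.
  by move=> v; rewrite -expect_lin//; exact: tame_site_product.
rewrite fdiff_lin (ihr h1) ?mulr0 ?addr0; last 2 first.
- by move=> x; rewrite /h1; case: eqVneq => [->|_]; [rewrite sp|exact: hj].
- move=> x xs xr; rewrite /h1; case: eqVneq => [->//|xa].
  by apply: hr => //; rewrite inE negb_or xa.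
have [ja|ja] := posnP (j a).
  rewrite (_ : site_product s h2 = fun=> 0).
    rewrite (@fdiff_ext _ _ _ _ (fun=> 0)) ?fdiff0// => v; exact: expect0.
  apply/funext => z; apply/eqP; rewrite /site_product prodf_seq_eq0; apply/hasP.
  exists a => //=; rewrite /h2 eqxx; move: sq; rewrite ja leqn0 size_poly_eq0.
  by move=> /eqP ->; rewrite horner0.
move: (jk); rewrite (bigD1_seq a)//= => jk'.
apply: (ihk k.-1 _ (fun x => if x == a then (j a).-1 else j x)) => //.
- by rewrite prednK//; lia.
- move=> x; rewrite /h2; case: eqVneq => [_|_]; last exact: hj.
  by rewrite prednK.
- rewrite (bigD1_seq a)//= eqxx.
  rewrite [X in (_ + X)%N](_ : _ = \sum_(i <- s | i != a) j i)%N; first by lia.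
  by apply: eq_bigr => x /negPf->.
- by lia.
Qed.

(** The dynamics commutes with the choice of [size s] of the particles. Indeed
    [choose_conf s] vanishes on configurations of fewer than [size s] particles, is
    the indicator of [conf_seq s] on those of [size s] particles, and has degree
    [size s]; its expectation keeps the first and the last property, so that it is
    determined by its values on [size s] particles. *)
Lemma consistency s y :
  St (choose_conf s) (conf_seq y) =
  \sum_(u <- subseqs y | size u == size s)
    fine (P t (conf_seq u) [set conf_seq s]).
Proof.
have tc := @tame_choose_conf R d s.
rewrite (@newton_top _ _ (size s)).
- apply: eq_bigr => u /eqP us.
  have mc := measurable_conf1 (conf_seq s).
  have ti : tame (\1_[set conf_seq s] : conf d -> R).
    split; first exact: measurable_indic.
    by move=> n; exists 1 => z _; rewrite indicE; case: (_ \in _); rewrite ?normr1 ?normr0.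
  rewrite (expect_sector tc ti); first by rewrite /expect integral_indic// setIT.
  by move=> z; rewrite us; exact: choose_conf_sector.
- move=> u us; rewrite -(expect0 u); apply: (expect_sector tc (@tame0 R d)) => z.
  exact: choose_conf_small.
- move=> u su; have [h [hs ->]] := @choose_conf_site_product R d s.
  have le_s : (\sum_(x <- undup s) count_mem x s <= size s)%N.
    by rewrite sum_count_mem_undup.
  exact: (expect_site_product_diff (undup_uniq s) hs le_s su).
Qed.

End consistency.

(** * Return probabilities *)

Section pointwise_bounds.
Context {R : realType} {d : nat}.
Implicit Types (x : site d) (s : seq (site d)).

Lemma leq_bin_exp n j : ('C(n, j) <= n ^ j)%N.
Proof.
elim: n j => [|n ih] [|j] //.
rewrite binS; apply: leq_trans (leq_add (ih _) (ih _)) _.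
rewrite [leqRHS]expnS mulSn [leqRHS]addnC [X in (X + _)%N]expnS.
have njn : (n ^ j <= n.+1 ^ j)%N by case: j => // j; rewrite leq_exp2r.
by rewrite leq_add// leq_mul.
Qed.

(** A product is at most a power of its largest factor. *)
Lemma prod_le_sum_exp (T : eqType) (r : seq T) (h : T -> nat) : r != [::] ->
  (\prod_(x <- r) h x <= \sum_(x <- r) h x ^ size r)%N.
Proof.
move=> r0; suff [x xr hx] : exists2 x, x \in r & (\prod_(x <- r) h x <= h x ^ size r)%N.
  by apply: leq_trans hx _; rewrite (big_rem x)//= leq_addr.
elim: r r0 => // a [|b r] ih _; first by exists a; rewrite ?inE// big_seq1 expn1.
have [x xr hx] := ih isT.
have [hax|hxa] := leqP (h a) (h x).
  by exists x; [rewrite inE xr orbT|rewrite big_cons [leqRHS]expnS leq_mul].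
exists a; first by rewrite inE eqxx.
by rewrite big_cons [leqRHS]expnS leq_mul// (leq_trans hx)// leq_exp2r// ltnW.
Qed.

Lemma choose_conf_le_sum s (zeta : conf d) : s != [::] ->
  choose_conf s zeta <= \sum_(x <- s) (zeta x)%:R ^+ size s :> R.
Proof.
move=> s0; apply: (@le_trans _ _ (\prod_(x <- s) zeta x)%:R).
  rewrite /choose_conf -natr_prod ler_nat -(big_undup_iterop_count _ s)/=.
  by apply: leq_prod => x _; exact: leq_bin_exp.
by rewrite (le_trans _ (y := (\sum_(x <- s) zeta x ^ size s)%:R)) ?ler_nat
  ?prod_le_sum_exp// natr_sum; under eq_bigr do rewrite natrX.
Qed.

(** Interpolation between the first and the [M]-th factorial moment. The first term
    suffices when [h <= v]. Otherwise [h] exceeds [M], so that [h <= M (h - i)] for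
    [i < M] and [h ^ M] is comparable with the factorial moment, whereas
    [h ^ k <= h ^ M v ^ (k - M)]. *)
Lemma exp_le_bin (h k M : nat) (v : R) : (0 < k)%N -> (k <= M)%N -> M%:R <= v ->
  0 < v ->
  h%:R ^+ k <= v ^+ k.-1 * h%:R + (M ^ M * M`!)%:R * (v ^+ k / v ^+ M) * 'C(h, M)%:R.
Proof.
move=> k0 kM Mv v0; have [hv|vh] := leP h%:R v.
  rewrite -[leLHS]addr0 lerD//.
    by rewrite -[in leLHS](prednK k0) exprSr ler_wpM2r// lerXn2r// nnegrE ?ler0n// ltW.
  by rewrite mulr_ge0// mulr_ge0// divr_ge0// exprn_ge0// ltW.
rewrite -[leLHS]add0r lerD//.
  by rewrite mulr_ge0// exprn_ge0// ltW.
have Mh : (M <= h)%N by rewrite -(ler_nat R) (le_trans Mv)// ltW.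
have hM : (h ^ M <= M ^ M * (M`! * 'C(h, M)))%N.
  rewrite [(M`! * _)%N]mulnC bin_ffact ffact_prod.
  have E n : (n ^ M = \prod_(i < M) n)%N by rewrite prod_nat_const card_ord.
  rewrite (E h) (E M) -big_split/=; apply: leq_prod => i _.
  have := ltn_ord i; move: Mh; nia.
have hM' : h%:R ^+ M <= (M ^ M * M`!)%:R * 'C(h, M)%:R :> R.
  by rewrite -natrX -natrM ler_nat -mulnA.
have vM : v ^+ M = v ^+ (M - k) * v ^+ k by rewrite -exprD subnK.
have -> : h%:R ^+ k = h%:R ^+ k * v ^+ (M - k) * (v ^+ k / v ^+ M) :> R.
  by rewrite vM; field; rewrite !expf_neq0 ?gt_eqF.
rewrite [leRHS]mulrAC ler_wpM2r ?divr_ge0 ?exprn_ge0 ?(ltW v0)//.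
apply: le_trans hM'; rewrite -[in leRHS](subnKC kM) exprD ler_wpM2l//.
by rewrite lerXn2r ?nnegrE// ltW.
Qed.

End pointwise_bounds.

Section return_probability.
Context {R : realType} {d : nat} {Omega0 : set (conf d)}
  {P : R -> R.-pker (conf d) ~> (conf d)} {D : conf d -> conf d -> R}.
Hypothesis systemP : is_particle_system Omega0 P.
Hypothesis D_duality : self_duality Omega0 P D.
Hypothesis D_factor : factorized_polynomials D.
Variables (t : R) (t_ge0 : 0 <= t).
Implicit Types (x a : site d) (s u y : seq (site d)).

Local Notation p_ := (fun xi xi' => fine (transition_probability P t xi xi')).

Definition copies (n : nat) s := flatten [seq nseq n x | x <- s].

Lemma size_copies n s : size (copies n s) = (n * size s)%N.
Proof. by elim: s => [|x s ih]; rewrite ?muln0//= size_cat size_nseq ih mulnS. Qed.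

Lemma transition_ge0 xi xi' : 0 <= p_ xi xi'.
Proof. exact/fine_ge0/measure_ge0. Qed.

(** By consistency the expectation is the sum of the transition probabilities of all
    choices of [size s] particles among the copies; those that take one particle in
    each group of copies all start from [s]. *)
Lemma transition_le_expect n s s' : size s = size s' ->
  n%:R ^+ size s * p_ (conf_seq s) (conf_seq s') <=
  expect P t (choose_conf s') (conf_seq (copies n s)).
Proof.
move=> ss'; rewrite (consistency systemP D_duality D_factor t_ge0).
apply: (@le_trans _ _ (\sum_(u <- subseqs (copies n s) | u == s)
    p_ (conf_seq u) (conf_seq s'))); last first.
  rewrite [leLHS]big_mkcond [leRHS]big_mkcond/=; apply: ler_sum => u _.
  have [->|_] := eqVneq u s; first by rewrite ss' eqxx.
  by case: ifP => // _; exact: transition_ge0.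
rewrite (eq_bigr (fun=> p_ (conf_seq s) (conf_seq s'))); last by move=> u /eqP ->.
rewrite big_const_seq iter_addr_0 -[leRHS]mulr_natl ler_wpM2r ?transition_ge0//.
by rewrite -natrX ler_nat count_subseqs_copies.
Qed.

(** The binomial coefficient counts the choices of [M] particles located at [a]; by
    consistency it is a sum of [M]-particle transition probabilities. *)
Lemma expect_bin_le (M : nat) y a (b : R) : (0 < M)%N ->
  (forall xi xi', sector M xi -> sector M xi' -> p_ xi xi' <= b) ->
  expect P t (fun zeta => 'C(zeta a, M)%:R) (conf_seq y) <= (size y)%:R ^+ M * b.
Proof.
move=> M0 hb.
have sM : size (nseq M a) = M by rewrite size_nseq.
have -> : (fun zeta : conf d => 'C(zeta a, M)%:R) = choose_conf (nseq M a) :> (_ -> R).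
  by apply/funext => z; rewrite /choose_conf undup_nseq// big_seq1 count_nseq/= eqxx mul1n.
have b0 : 0 <= b.
  apply: le_trans (hb (conf_seq (nseq M a)) (conf_seq (nseq M a)) _ _).
  - exact: transition_ge0.
  - by apply/sectorP; exists (nseq M a).
  - by apply/sectorP; exists (nseq M a).
rewrite (consistency systemP D_duality D_factor t_ge0) sM.
apply: (@le_trans _ _ (\sum_(u <- subseqs y | size u == M) b)).
  apply: ler_sum => u /eqP uM; apply: hb; apply/sectorP; last by exists (nseq M a).
  by exists u.
rewrite big_const_seq iter_addr_0 -[leLHS]mulr_natl ler_wpM2r//.
by rewrite -natrX ler_nat count_subseqs_size leq_bin_exp.
Qed.

Lemma sum_shifted_occupation (ws : seq (site d)) x (zeta : conf d) n : uniq ws ->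
  sector n zeta -> (\sum_(w <- ws) zeta (w + x)%R <= n)%N.
Proof.
move=> uws /sectorP[u <- <-]; rewrite -(mass_conf_seq u).
pose ws' := [seq w + x | w <- ws].
have uws' : uniq ws' by rewrite map_inj_uniq//; exact: addIr.
rewrite -(big_map (fun w => w + x) predT (conf_seq u)) -/ws'.
rewrite (@mass_sum _ _ (ws' ++ [seq v <- undup u | v \notin ws'])).
- by rewrite big_cat leq_addr.
- rewrite cat_uniq uws' filter_uniq ?undup_uniq// andbT.
  by apply/hasPn => v; rewrite mem_filter => /andP[].
- move=> v; rewrite mem_cat negb_or mem_filter mem_undup => /andP[vws].
  by rewrite vws/= => /count_memPn.
Qed.

(** The start is multiplied: with [L] copies of [s], that is [n = L k] particles, the
    left-hand side times [L ^ k] is at most the sum over [w] and [x] of the expected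
    [k]-th powers of the occupation numbers at [w + x]. Each power is interpolated at
    the level [v = n mu]. The sum over [w] of the linear terms is at most the number
    [n] of particles; the factorial moments are bounded by the [M]-particle kernel.
    All the terms scale like [L ^ k], so [L] disappears, and only its size is used,
    through [M <= v]. *)
Lemma sum_transition_le (s x0 ws : seq (site d)) (c : site d -> R) (cm b mu : R)
    (M : nat) :
  uniq ws -> (forall w, 0 <= c w <= cm) -> size s = size x0 -> (0 < size x0)%N ->
  (size x0 <= M)%N -> 0 < mu ->
  (forall xi xi', sector M xi -> sector M xi' -> p_ xi xi' <= b) ->
  \sum_(w <- ws) c w * p_ (conf_seq s) (conf_seq [seq w + x | x <- x0]) <=
  (size x0)%:R ^+ size x0 * (size x0)%:R *
   (cm * mu ^+ (size x0).-1 +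
    (M ^ M * M`!)%:R * (mu ^+ size x0 / mu ^+ M) * b * \sum_(w <- ws) c w).
Proof.
move=> uws c0 ss0; set k := size x0 => k0 kM mu0 hb.
have cm0 : 0 <= cm by have /andP[/le_trans] := c0 0; exact.
have M0 := leq_trans k0 kM.
(* enough copies for the level v = n mu to exceed M *)
pose L := (Num.truncn (M%:R / mu)).+1; pose n := (L * k)%N.
have L0 : (0 < L%:R :> R) by rewrite ltr0n.
have kR0 : (0 < k%:R :> R) by rewrite ltr0n.
have n0 : 0 < n%:R :> R by rewrite natrM mulr_gt0.
pose v := n%:R * mu; have v0 : 0 < v by rewrite mulr_gt0.
have Mv : M%:R <= v.
  rewrite /v natrM -ler_pdivrMr// (@le_trans _ _ L%:R)//.
    by rewrite ltW// truncnS_gt.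
  by rewrite ler_peMr ?ler1n ?ler0n.
have tameC f a := @tame_occupation R d f a.
pose K : R := (M ^ M * M`!)%:R * (v ^+ k / v ^+ M).
have K0 : 0 <= K by rewrite mulr_ge0// divr_ge0// exprn_ge0// ltW.
pose y := copies L s.
have sy : size y = n by rewrite /y size_copies ss0.
pose A (z : conf d) := \sum_(w <- ws) c w * \sum_(x <- x0) 1 * 'C(z (w + x), M)%:R : R.
have tame1 w : tame (fun z : conf d => \sum_(x <- x0) 1 * 'C(z (w + x), M)%:R : R).
  by apply: tame_sum => x; exact: tameC (fun m => 'C(m, M)%:R) (w + x).
have tA : tame A by exact: tame_sum.
have EA : expect P t A (conf_seq y) <= \sum_(w <- ws) c w * (k%:R * (n%:R ^+ M * b)).
  rewrite (expect_sum systemP t_ge0)//; apply: ler_sum => w _.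
  rewrite ler_wpM2l//; first by have /andP[] := c0 w.
  rewrite (expect_sum systemP t_ge0); last first.
    by move=> x; exact: tameC (fun m => 'C(m, M)%:R) (w + x).
  rewrite (le_trans (y := \sum_(x <- x0) n%:R ^+ M * b))//.
    by apply: ler_sum => x _; rewrite mul1r -sy expect_bin_le.
  by rewrite big_const_seq count_predT iter_addr_0 -[leLHS]mulr_natl.
have step : L%:R ^+ k *
    \sum_(w <- ws) c w * p_ (conf_seq s) (conf_seq [seq w + x | x <- x0]) <=
    v ^+ k.-1 * cm * k%:R * n%:R + K * \sum_(w <- ws) c w * (k%:R * (n%:R ^+ M * b)).
  apply: (@le_trans _ _ (expect P t (fun z => \sum_(w <- ws) c w *
      choose_conf [seq w + x | x <- x0] z) (conf_seq y))).
    rewrite (expect_sum systemP t_ge0); last by move=> w; exact: tame_choose_conf.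
    rewrite mulr_sumr; apply: ler_sum => w _; rewrite mulrCA ler_wpM2l//.
      by have /andP[] := c0 w.
    by rewrite /k -ss0; apply: transition_le_expect; rewrite size_map.
  apply: (@le_trans _ _ (expect P t (fun z => v ^+ k.-1 * cm * k%:R * n%:R + K * A z)
      (conf_seq y))); last first.
    rewrite (expect_lin systemP t_ge0)//; last first.
      split; first exact: measurable_cst.
      by move=> m; exists `|v ^+ k.-1 * cm * k%:R * n%:R|.
    by rewrite expect_cst lerD// ler_wpM2l.
  apply: (expect_le systemP t_ge0).
  - by apply: tame_sum => w; exact: tame_choose_conf.
  - apply: tameD => //; split; first exact: measurable_cst.
    by move=> m; exists `|v ^+ k.-1 * cm * k%:R * n%:R|.
  move=> z; rewrite sy => sz.
  apply: (@le_trans _ _ (\sum_(w <- ws) c w * \sum_(x <- x0)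
      (v ^+ k.-1 * (z (w + x))%:R + K * 'C(z (w + x), M)%:R))).
    apply: ler_sum => w _; rewrite ler_wpM2l//; first by have /andP[] := c0 w.
    rewrite (le_trans (choose_conf_le_sum _ _)) ?size_map -/k//.
      by rewrite -size_eq0 size_map -lt0n.
    by rewrite big_map; apply: ler_sum => x _; exact: exp_le_bin.
  have -> : \sum_(w <- ws) c w * \sum_(x <- x0)
      (v ^+ k.-1 * (z (w + x))%:R + K * 'C(z (w + x), M)%:R) =
      v ^+ k.-1 * (\sum_(x <- x0) \sum_(w <- ws) c w * (z (w + x))%:R) + K * A z.
    rewrite /A [X in v ^+ k.-1 * X]exchange_big/= [X in _ = X + _]mulr_sumr.
    rewrite [X in _ = _ + X]mulr_sumr -big_split/=; apply: eq_bigr => w _.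
    rewrite [LHS]mulr_sumr [X in _ = X + _]mulr_sumr [X in _ = _ + X]mulrA.
    rewrite [X in _ = _ + X]mulr_sumr -big_split/=; apply: eq_bigr => x _; ring.
  rewrite lerD2r -!mulrA ler_wpM2l ?exprn_ge0 ?(ltW v0)//.
  apply: (@le_trans _ _ (\sum_(x <- x0) cm * n%:R)).
    apply: ler_sum => x _; apply: (@le_trans _ _ (\sum_(w <- ws) cm * (z (w + x))%:R)).
      by apply: ler_sum => w _; rewrite ler_wpM2r//; have /andP[] := c0 w.
    by rewrite -mulr_sumr ler_wpM2l// -natr_sum ler_nat sum_shifted_occupation.
  by rewrite big_const_seq count_predT iter_addr_0 -[leLHS]mulr_natl mulrCA.
rewrite -(ler_pM2l (exprn_gt0 k L0)); apply: le_trans step _.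
rewrite -mulr_suml /K /v; set S := \sum_(w <- ws) c w.
rewrite le_eqVlt; apply/orP; left; apply/eqP.
have -> : (n%:R * mu) ^+ k.-1 = n%:R ^+ k / n%:R * mu ^+ k.-1.
  have -> : n%:R ^+ k = n%:R ^+ k.-1 * n%:R :> R by rewrite -exprSr prednK.
  by rewrite mulfK ?gt_eqF// exprMn.
have -> : L%:R ^+ k * (k%:R ^+ k * k%:R * (cm * mu ^+ k.-1 +
   (M ^ M * M`!)%:R * (mu ^+ k / mu ^+ M) * b * S)) = n%:R ^+ k * (k%:R * (cm * mu ^+ k.-1 +
   (M ^ M * M`!)%:R * (mu ^+ k / mu ^+ M) * b * S)) by rewrite /n [(L * k)%:R]natrM exprMn; ring.
by rewrite !exprMn; field; rewrite !expf_neq0 ?gt_eqF.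
Qed.

End return_probability.

(** * Lattice sums of a Schwartz function *)

Section schwartz_sums.
Context {R : realType} {d : nat}.
Implicit Types (phi : 'rV[R]_d -> R).

(** The product expands into squares of monomials, one for every set of coordinates,
    and each of them is controlled by a Schwartz seminorm. *)
Lemma schwartz_decay phi : schwartz phi ->
  exists2 B : R, 0 <= B & forall x, `|phi x| * \prod_(i < d) (1 + x 0 i ^+ 2) <= B.
Proof.
move=> [_ sphi]; pose al (J : {set 'I_d}) (i : 'I_d) := (2 * (i \in J))%N.
have [M hM] := choice (fun J : {set 'I_d} => sphi (al J) [::]).
exists (\sum_(J : {set 'I_d}) `|M J|) => [|x]; first exact: sumr_ge0.
rewrite (eq_bigr (fun i => x 0 i ^+ 2 + 1)); last by move=> i _; rewrite addrC.
rewrite bigA_distr mulr_sumr; apply: ler_sum => J _.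
apply: le_trans (le_trans (hM J x) (ler_norm _)).
rewrite normrM mulrC ler_wpM2r// (le_trans _ (ler_norm _))//.
rewrite le_eqVlt; apply/orP; left; apply/eqP; apply: eq_bigr => i _.
by rewrite /al; case: (i \in J).
Qed.

(** Bounded by [N], with increments bounding the summands below, whose sum
    therefore telescopes. *)
Let F (N x : R) := N * x / (N + `|x|).

Lemma F_bound N x : 0 < N -> `|F N x| <= N.
Proof.
move=> N0; rewrite /F normrM normfV normrM gtr0_norm//.
rewrite [ `|N + _|]gtr0_norm ?ltr_wpDr// ler_pdivrMr ?ltr_wpDr//.
by rewrite ler_pM2l// lerDr ltW.
Qed.

Lemma inv_sq_le_increment (N : R) (j : int) : 1 <= N ->
  (1 + (j%:~R / N) ^+ 2)^-1 <= 4 * (F N (j%:~R + 1) - F N j%:~R).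
Proof.
move=> N1; have N0 : 0 < N by lra.
have -> : (1 + (j%:~R / N) ^+ 2)^-1 = N ^+ 2 / (N ^+ 2 + j%:~R ^+ 2) :> R.
  by field; rewrite !gt_eqF ?ltr_wpDr ?sqr_ge0 ?exprn_gt0.
have [j0|j0] := leP 0 j.
  have x0 : 0 <= j%:~R :> R by rewrite ler0z.
  move: (j%:~R : R) x0 => x x0; rewrite /F !ger0_norm//; last by lra.
  have -> : N * (x + 1) / (N + (x + 1)) - N * x / (N + x) =
    N ^+ 2 / ((N + (x + 1)) * (N + x)) by field; apply/andP; split; lra.
  rewrite mulrCA ler_wpM2l ?sqr_ge0// -[4]invrK -invfM lef_pV2 ?posrE; last 2 first.
  - by rewrite ltr_wpDr ?sqr_ge0 ?exprn_gt0.
  - by rewrite !mulr_gt0//; lra.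
  have h1 : N + x <= (N + x) ^+ 2 by rewrite expr2 ler_peMl//; lra.
  have h2 : 0 <= (N - x) ^+ 2 by exact: sqr_ge0.
  by lra.
have x1 : j%:~R <= -1 :> R by rewrite -[-1]/((-1)%:~R) ler_int; lia.
move: (j%:~R : R) x1 => x x1; rewrite /F !ler0_norm; [|lra..].
have -> : N * (x + 1) / (N - (x + 1)) - N * x / (N - x) =
  N ^+ 2 / ((N - (x + 1)) * (N - x)) by field; apply/andP; split; lra.
rewrite mulrCA ler_wpM2l ?sqr_ge0// -[4]invrK -invfM lef_pV2 ?posrE; last 2 first.
- by rewrite ltr_wpDr ?sqr_ge0 ?exprn_gt0.
- by rewrite !mulr_gt0//; lra.
have h1 : N - x <= (N - x) ^+ 2 by rewrite expr2 ler_peMl//; lra.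
have h2 : 0 <= (N + x) ^+ 2 by exact: sqr_ge0.
by lra.
Qed.

Lemma sum_inv_sq_le (N : R) (m n : nat) : 1 <= N ->
  \sum_(i < n) (1 + ((i%:R - m%:R) / N) ^+ 2)^-1 <= 8 * N.
Proof.
move=> N1; have N0 : 0 < N by lra.
pose G (i : nat) := F N (i%:R - m%:R).
apply: (@le_trans _ _ (\sum_(0 <= i < n) 4 * (G i.+1 - G i))).
  rewrite big_mkord; apply: ler_sum => i _; rewrite /G.
  have := @inv_sq_le_increment N (Posz i - Posz m)%R N1.
  rewrite intrB -!pmulrn (_ : i.+1%:R - m%:R = i%:R - m%:R + 1)//.
  by rewrite -natr1 addrAC.
rewrite -mulr_sumr telescope_sumr//.
have := F_bound (n%:R - m%:R) N0; have := F_bound (0%:R - m%:R) N0.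
by rewrite !ler_norml -/(G n) -/(G 0%N) => /andP[a1 a2] /andP[b1 b2]; lra.
Qed.

(** The points lie in a cube, where the sum of products is a product of sums. *)
Lemma sum_prod_lattice_le (N : R) (ws : seq 'rV[int]_d) : 1 <= N -> uniq ws ->
  \sum_(w <- ws) \prod_(i < d) (1 + ((w 0 i)%:~R / N) ^+ 2)^-1 <= (8 * N) ^+ d.
Proof.
move=> N1 uws.
pose m := (\max_(w <- ws) \max_(i < d) absz (w 0%R i))%N.
have hm w i : w \in ws -> (absz (w 0%R i) <= m)%N.
  move=> wws; apply: (@leq_trans (\max_(i < d) absz (w 0%R i))).
    by rewrite (bigD1 i)//= leq_maxl.
  by rewrite /m (big_rem w)//= leq_maxl.
pose enc (w : 'rV[int]_d) : {ffun 'I_d -> 'I_(2 * m).+1} :=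
  [ffun i => inord (absz (w 0 i + m%:Z))].
have encE w i : w \in ws -> (enc w i : nat)%:Z = w 0 i + m%:Z.
  move=> wws; rewrite ffunE; have := hm w i wws; move: (w 0 i) => z zm.
  have z0 : 0 <= z + m%:Z by lia.
  rewrite inordK; first by rewrite gez0_abs.
  by have := gez0_abs z0; lia.
pose g (j : nat) : R := (1 + ((j%:R - m%:R) / N) ^+ 2)^-1.
have g0 j : 0 <= g j by rewrite invr_ge0 addr_ge0// sqr_ge0.
have enc_inj : {in ws &, injective enc}.
  move=> w w' wws wws' e; apply/rowP => i.
  by apply: (addIr m%:Z); rewrite -!encE// e.
have uenc : uniq (map enc ws) by rewrite map_inj_in_uniq.
apply: (@le_trans _ _ (\sum_(f <- map enc ws) \prod_(i < d) g (f i))).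
  rewrite big_map big_seq [leRHS]big_seq; apply: ler_sum => w wws.
  apply: ler_prod => i _; rewrite invr_ge0 addr_ge0 ?sqr_ge0//= /g.
  rewrite (_ : (enc w i : nat)%:R - m%:R = (w 0 i)%:~R :> R)//.
  have := congr1 (fun z : int => z%:~R : R) (encE w i wws).
  by rewrite intrD -!pmulrn => ->; rewrite addrK.
rewrite big_uniq//=; apply: (@le_trans _ _ (\sum_(f : {ffun 'I_d -> 'I_(2 * m).+1})
    \prod_(i < d) g (f i))).
  by rewrite [leRHS](bigID (mem (map enc ws)))/= lerDl sumr_ge0// => f _; exact: prodr_ge0.
rewrite -(bigA_distr_bigA (fun (i : 'I_d) (j : 'I_(2 * m).+1) => g j)).
rewrite prodr_const card_ord lerXn2r ?nnegrE ?sumr_ge0//; first by lra.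
exact: sum_inv_sq_le.
Qed.

Lemma schwartz_lattice_sum phi : schwartz phi -> exists B : R,
  0 <= B /\ (forall x, `|phi x| <= B) /\
  forall (N : nat) (ws : seq 'rV[int]_d), (0 < N)%N -> uniq ws ->
    \sum_(w <- ws) `|phi (\row_(i < d) ((w 0 i)%:~R / N%:R))| <= B * N%:R ^+ d.
Proof.
move=> /schwartz_decay[B B0 hB]; exists (B * 8 ^+ d).
have p1 (x : 'rV[R]_d) : 1 <= \prod_(i < d) (1 + x 0 i ^+ 2).
  elim/big_ind: _ => // [a b|i _]; first exact: mulr_ege1.
  by rewrite lerDl sqr_ge0.
have e1 : 1 <= 8 ^+ d :> R by apply: exprn_ege1; lra.
split; first by rewrite mulr_ge0// (le_trans _ e1).
split=> [x|N ws N0 uws].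
  rewrite (le_trans (y := B))// ?ler_peMr//.
  by apply: le_trans (hB x); rewrite ler_peMr.
rewrite -mulrA -exprMn.
apply: (@le_trans _ _ (\sum_(w <- ws) B * \prod_(i < d) (1 + ((w 0 i)%:~R / N%:R) ^+ 2)^-1)).
  apply: ler_sum => w _; have := hB (\row_(i < d) ((w 0 i)%:~R / N%:R)).
  rewrite prodfV -ler_pdivlMr ?(lt_le_trans _ (p1 _))// => /le_trans; apply.
  rewrite le_eqVlt; apply/orP; left; apply/eqP; congr (_ / _).
  by apply: eq_bigr => i _; rewrite mxE.
rewrite -mulr_sumr ler_wpM2l//; apply: sum_prod_lattice_le => //.
by rewrite ler1n.
Qed.

End schwartz_sums.

(** * The law of the process at two times *)

Section two_time_law.
Context {R : realType} {d1 d2 d3 : measure_display} {T : measurableType d1}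
  {T' : measurableType d2} {W : measurableType d3}.
Variables (k : R.-pker T ~> T') (nu : probability T R) (Pr : probability W R).
Local Open Scope ereal_scope.

(** A name for [k x] to which the structure of a subprobability is attached. *)
Definition kernel_law (x : T) : set T' -> \bar R := k x.
HB.instance Definition _ x := Measure.copy (kernel_law x) (k x).

Let kernel_law_setT x : kernel_law x setT <= 1.
Proof. by rewrite /kernel_law prob_kernel. Qed.
HB.instance Definition _ x :=
  Measure_isSubProbability.Build _ _ _ (kernel_law x) (kernel_law_setT x).

(** The law of [(x, y)] with [y] drawn from [k x]; integrating it over [nu] gives
    the law of the process at two times. *)
Let law_graph (x : T) : giry (T * T')%type R :=
  giry_prod (giry_ret x, (kernel_law x : subprobability T' R)).

Let measurable_law_graph : measurable_fun setT law_graph.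
Proof.
apply: (measurableT_comp (f := giry_prod)); first exact: measurable_giry_prod.
apply: measurable_fun_pair; first exact: measurable_giry_ret.
apply: measurable_giry_codensity => // B mB.
exact: (measurable_kernel k).
Qed.

Let graph_law : giry (T * T')%type R := giry_bind (nu : subprobability T R) measurable_law_graph.

Let graph_lawE (h : T * T' -> \bar R) : measurable_fun setT h ->
  (forall z, 0 <= h z) ->
  \int[graph_law]_z h z = \int[nu]_x \int[k x]_y h (x, y).
Proof.
move=> mh h0; rewrite -[LHS]/(giry_int graph_law h) giry_int_bind//.
apply: eq_integral => x _.
rewrite giry_int_prod1// giry_int_ret//.
exact: (measurable_fun_fubini_tonelli_F (m2 := kernel_law x)).
Qed.

Lemma measurable_integral_graph (h : T * T' -> \bar R) : measurable_fun setT h ->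
  measurable_fun setT (fun x => \int[k x]_y h (x, y)).
Proof.
move=> mh.
have -> : (fun x => \int[k x]_y h (x, y)) =
    (fun x => \int[k x]_y h^\+ (x, y) - \int[k x]_y h^\- (x, y)).
  apply/funext => x; rewrite integralE.
  by congr (_ - _); apply: eq_integral => y _; rewrite ?funeposE ?funenegE.
apply: emeasurable_funB.
- by apply: (@measurable_kfcomp _ _ T T' R k _ (measurable_funepos mh)).
- by apply: (@measurable_kfcomp _ _ T T' R k _ (measurable_funeneg mh)).
Qed.

Variables (Omega0 : set T) (X : W -> T) (Y : W -> T').
Hypotheses (mOmega0 : measurable Omega0) (nuOmega0 : nu Omega0 = 1)
  (mX : measurable_fun setT X) (mY : measurable_fun setT Y)
  (lawX : forall A, measurable A -> Pr (X @^-1` A) = nu A)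
  (markov : forall A B, measurable A -> measurable B ->
    Pr (X @^-1` A `&` Y @^-1` B) =
    \int[Pr]_(w in X @^-1` A `&` X @^-1` Omega0) k (X w) B).

Let mZ : measurable_fun setT (fun w => (X w, Y w)).
Proof. exact: measurable_fun_pair. Qed.

Let pair_law : {measure set (T * T') -> \bar R} :=
  measure_function_pushforward__canonical__measure_function_Measure Pr mZ.
Let X_law : {measure set T -> \bar R} :=
  measure_function_pushforward__canonical__measure_function_Measure Pr mX.

(** On rectangles the equality of the two laws is the Markov property. *)
Let pair_law_rect A B : measurable A -> measurable B ->
  graph_law (A `*` B) = pair_law (A `*` B).
Proof.
move=> mA mB.
have mAB : measurable (A `*` B) by exact: measurableX.
have mkB : measurable_fun setT (k ^~ B) by exact: (measurable_kernel k).
transitivity (\int[nu]_(x in A `&` Omega0) k x B).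
  transitivity (\int[graph_law]_z (\1_(A `*` B) z)%:E).
    by rewrite integral_indic// setIT.
  rewrite graph_lawE//; last first.
    by apply/measurable_EFinP; exact: measurable_indic.
  transitivity (\int[nu]_(x in A) k x B).
    rewrite [RHS]integral_mkcond; apply: eq_integral => x _.
    rewrite patchE; case: ifPn => [xA|xA].
      transitivity (\int[k x]_y (\1_B y)%:E).
        by apply: eq_integral => y _; rewrite !indicE in_setX xA.
      by rewrite integral_indic// setIT.
    by rewrite integral0_eq// => y _; rewrite indicE in_setX (negPf xA).
  rewrite [RHS]integral_mkcond [LHS]integral_mkcond.
  apply: (ae_full_integral mOmega0) => //.
  - exact: probability_setT.
  - by apply/(measurable_restrictT _ mA); exact: measurable_funTS.
  - have mAO : measurable (A `&` Omega0) by exact: measurableI.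
    apply/(measurable_restrictT _ mAO).
    exact: measurable_funTS.
  - by move=> x xO; rewrite !patchE in_setI xO andbT.
rewrite -[RHS]/(Pr (X @^-1` A `&` Y @^-1` B)) markov// -preimage_setI.
rewrite (eq_measure_integral X_law); last by move=> B' mB' _; exact/esym/lawX.
have mAO : measurable (A `&` Omega0) by exact: measurableI.
by rewrite (ge0_integral_pushforward mX Pr mAO)//; exact: measurable_funTS.
Qed.

(** The law of [(X, Y)] is determined by the rectangles. *)
Lemma ge0_integral_two_times (h : T * T' -> \bar R) : measurable_fun setT h ->
  (forall z, 0 <= h z) ->
  \int[Pr]_w h (X w, Y w) = \int[nu]_x \int[k x]_y h (x, y).
Proof.
move=> mh h0; rewrite -graph_lawE//.
transitivity (\int[pair_law]_z h z).
  by rewrite ge0_integral_pushforward.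
apply: eq_measure_integral => A mA _.
pose G := [set A `*` B | A in @measurable _ T & B in @measurable _ T'].
apply: (measure_unique G (fun=> setT)) => //.
- by rewrite measurable_prod_measurableType.
- move=> _ _ [A1 mA1 [A2 mA2 <-]] [B1 mB1 [B2 mB2 <-]].
  rewrite -setXI; exists (A1 `&` B1); first exact: measurableI.
  by exists (A2 `&` B2); first exact: measurableI.
- by move=> _; exists setT => //; exists setT => //; rewrite setXTT.
- by rewrite bigcup_const.
- by move=> _ [A1 mA1 [A2 mA2 <-]]; have := pair_law_rect mA1 mA2.
- by move=> _; apply: (@le_lt_trans _ _ 1); [rewrite -(probability_setT Pr)|rewrite ltry].
Qed.

Lemma integral_two_times (h : T * T' -> \bar R) : measurable_fun setT h ->
  Pr.-integrable setT (fun w => h (X w, Y w)) ->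
  \int[Pr]_w h (X w, Y w) = \int[nu]_x \int[k x]_y h (x, y).
Proof.
move=> mh ih; have mZh : measurable_fun setT (fun w => h (X w, Y w)).
  exact: (measurableT_comp mh mZ).
have mhp := measurable_funepos mh; have mhn := measurable_funeneg mh.
have ep := ge0_integral_two_times mhp (funepos_ge0 h).
have en := ge0_integral_two_times mhn (funeneg_ge0 h).
have mF (g : T * T' -> \bar R) : measurable_fun setT g -> (forall z, 0 <= g z) ->
    measurable_fun setT (fun x => \int[k x]_y g (x, y)).
  by move=> mg g0; exact: (@measurable_kfcomp _ _ T T' R k g mg g0).
have iF (g : T * T' -> \bar R) : measurable_fun setT g -> (forall z, 0 <= g z) ->
    \int[nu]_x \int[k x]_y g (x, y) < +oo ->
    nu.-integrable setT (fun x => \int[k x]_y g (x, y)).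
  move=> mg g0 goo; apply/integrableP; split; first exact: mF.
  under eq_integral => x _ do rewrite gee0_abs ?integral_ge0//.
  by [].
have pE : \int[Pr]_w (fun w => h (X w, Y w))^\+ w = \int[Pr]_w h^\+ (X w, Y w).
  by apply: eq_integral => w _; rewrite !funeposE.
have nE : \int[Pr]_w (fun w => h (X w, Y w))^\- w = \int[Pr]_w h^\- (X w, Y w).
  by apply: eq_integral => w _; rewrite !funenegE.
have poo := integral_funepos_lt_pinfty measurableT ih.
have noo := integral_funeneg_lt_pinfty measurableT ih.
rewrite pE ep in poo; rewrite nE en in noo.
rewrite integralE pE nE ep en -integralB//; last 2 first.
- exact: iF.
- exact: iF.
apply: eq_integral => x _; rewrite [RHS]integralE.
by congr (_ - _); apply: eq_integral => y _; rewrite ?funeposE ?funenegE.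
Qed.

End two_time_law.

(** * Second moments under the product measure *)

Section product_measure.
Context {R : realType} {d : nat}.
Local Open Scope ereal_scope.
Implicit Types (s : seq (site d)).

Lemma nat_indicator_series (g : nat -> \bar R) (n : nat) : (forall n, 0 <= g n) ->
  g n = \sum_(i <oo) g i * (\1_[set i] n)%:E.
Proof.
move=> g0; rewrite (@nneseriesD1 _ _ n xpredT)//; last first.
  by move=> i _; rewrite mule_ge0// lee_fin.
rewrite eseries0 => [|i _ /= ni].
  by rewrite adde0 indicE mem_set// mule1.
by rewrite indicE memNset ?mule0//= => nE; rewrite nE eqxx in ni.
Qed.

Lemma ge0_integral_nat (m : {measure set nat -> \bar R}) (g : nat -> \bar R) :
  (forall n, 0 <= g n) -> \int[m]_n g n = \sum_(i <oo) g i * m [set i].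
Proof.
move=> g0; under [LHS]eq_integral => n _ do rewrite (nat_indicator_series n g0).
rewrite integral_nneseries//; last by move=> i n _; rewrite mule_ge0// lee_fin.
apply: eq_eseriesr => n _; rewrite ge0_integralZl ?integral_indic ?setIT//.
Qed.

Definition cylinder s (A : site d -> set nat) : set (conf d) :=
  [set eta | forall x, x \in s -> A x (eta x)].

Lemma measurable_cylinder s A : measurable (cylinder s A).
Proof.
elim: s => [|a s ih].
  rewrite (_ : cylinder _ _ = setT); first exact: measurableT.
  by apply/seteqP; split.
rewrite (_ : cylinder _ _ = (fun eta : conf d => eta a) @^-1` (A a) `&` cylinder s A).
  apply: measurableI => //; rewrite -[X in measurable X]setTI.
  exact: measurable_occupation.
apply/seteqP; split => eta.
  move=> h; split; first exact: (h a (mem_head a s)).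
  by move=> x xs; apply: h; rewrite inE xs orbT.
by move=> [h1 h2] x; rewrite inE => /predU1P[->//|]; exact: h2.
Qed.

Variables (nu : probability (conf d) R) (m : probability nat R).
Hypothesis nuE : forall s (A : site d -> set nat), uniq s ->
  nu (cylinder s A) = \prod_(x <- s) m (A x).

(** The product measure is given through cylinders. The sites of [s1] are moved one
    by one into the cylinder, by splitting according to the value of [eta a]. *)
Lemma expect_prod_occupation (s1 s2 : seq (site d)) (A : site d -> set nat)
    (f : site d -> nat -> R) : (forall x n, 0 <= f x n)%R -> uniq (s1 ++ s2) ->
  \int[nu]_eta ((\prod_(x <- s1) f x (eta x)) * \1_(cylinder s2 A) eta)%:E =
  (\prod_(x <- s1) \int[m]_n (f x n)%:E) * \prod_(x <- s2) m (A x).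
Proof.
move=> f0; elim: s1 s2 A => [|a s1 ih] s2 A us.
  under eq_integral => eta _ do rewrite big_nil mul1r.
  have mc := measurable_cylinder s2 A.
  by rewrite integral_indic ?setIT ?big_nil ?mul1e//; exact: nuE.
pose A' n x := if x == a then [set n] else A x.
move: us => /= /andP[]; rewrite mem_cat negb_or => /andP[as1 as2] us.
have us' : uniq (s1 ++ a :: s2).
  by rewrite uniq_catC/= mem_cat negb_or as1 as2/= uniq_catC.
have A'E n : \prod_(x <- a :: s2) m (A' n x) = m [set n] * \prod_(x <- s2) m (A x).
  rewrite big_cons /A' eqxx; congr (_ * _); apply: eq_big_seq => x xs.
  by case: eqVneq => // xa; rewrite -xa xs in as2.
have cE n eta : (\1_[set n] (eta a) * \1_(cylinder s2 A) eta =
    \1_(cylinder (a :: s2) (A' n)) eta :> R)%R.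
  rewrite !indicE -natrM mulnb; congr (_%:R); congr nat_of_bool.
  apply/idP/idP => [/andP[]|].
    rewrite !inE => /= e h x; rewrite inE /A' => /predU1P[->|xs].
      by rewrite eqxx.
    by case: eqVneq => [xa|_]; [rewrite -xa xs in as2|exact: h].
  rewrite inE => h; apply/andP; split; rewrite inE /=.
    by have := h a (mem_head a s2); rewrite /A' eqxx.
  move=> x xs; have := h x; rewrite inE xs orbT /A' => /(_ isT).
  by case: eqVneq => // xa; rewrite -xa xs in as2.
transitivity (\int[nu]_eta \sum_(n <oo) (f a n)%:E *
    ((\prod_(x <- s1) f x (eta x)) * \1_(cylinder (a :: s2) (A' n)) eta)%:E).
  apply: eq_integral => eta _; rewrite big_cons.
  rewrite -mulrA EFinM (nat_indicator_series (g := fun n => (f a n)%:E) (eta a)); last first.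
    by move=> n; rewrite lee_fin.
  rewrite muleC -nneseriesZl; last by move=> i _; rewrite mule_ge0// lee_fin.
  apply: eq_eseriesr => n _; rewrite -!EFinM -cE; congr EFin; ring.
have m1 n : measurable_fun setT (fun eta : conf d =>
    ((\prod_(x <- s1) f x (eta x)) * \1_(cylinder (a :: s2) (A' n)) eta)%:E).
  apply/measurable_EFinP/measurable_funM; first exact: measurable_prod_occupation.
  by apply: measurable_indic; exact: measurable_cylinder.
have p0 eta : (0 <= \prod_(x <- s1) f x (eta x))%R by exact: prodr_ge0.
rewrite integral_nneseries//; last 2 first.
- by move=> n; apply: emeasurable_funM => //; exact: measurable_cst.
- by move=> n eta _; rewrite -EFinM lee_fin !mulr_ge0.
have ei x : 0 <= \int[m]_n (f x n)%:E.
  by apply: integral_ge0 => n _; rewrite lee_fin.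
have C0 : 0 <= (\prod_(x <- s1) \int[m]_n (f x n)%:E) * \prod_(x <- s2) m (A x).
  by apply: mule_ge0; apply: prode_ge0.
rewrite big_cons -muleA [RHS]muleC -ge0_integralZl//; last first.
  by move=> n _; rewrite lee_fin.
rewrite ge0_integral_nat; last by move=> n; rewrite mule_ge0// lee_fin.
apply: eq_eseriesr => n _; rewrite ge0_integralZl_EFin//; last first.
  by move=> eta _; rewrite lee_fin mulr_ge0.
rewrite ih// A'E muleCA muleA [in RHS]muleC !muleA.
rewrite [RHS]muleAC; congr (_ * _); rewrite muleC muleA//.
Qed.

End product_measure.

Section second_moment.
Context {R : realType} {d : nat} (nu : probability (conf d) R)
  (D : conf d -> conf d -> R).
Hypotheses (nu_product : homogeneous_product nu) (D_factor : factorized_polynomials D)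
  (D_orth : orthogonal_polynomials nu D).
Local Open Scope ereal_scope.
Implicit Types s : seq (site d).

Lemma measurable_duality xi : finite_conf xi -> measurable_fun setT (D xi).
Proof.
move=> /finite_conf_seq[s <- _]; have [p [_ DE]] := duality_site_product D_factor.
rewrite (DE (undup s)) ?undup_uniq//; first exact: measurable_site_product.
by move=> x; rewrite mem_undup => /count_memPn.
Qed.

Lemma second_moment_lty xi : finite_conf xi -> \int[nu]_eta ((D xi eta) ^+ 2)%:E < +oo.
Proof.
move=> fxi; have [aoo /(_ _ _ fxi fxi)] := D_orth.
under eq_integral => eta _ do rewrite -expr2.
by move=> ->; rewrite eqxx mul1e; exact: aoo.
Qed.

(** By independence the second moment is a product over the occupied sites of factors
    depending on the occupation number, which takes at most [k] values there. *)
Lemma second_moment_bounded k : exists2 B : R, (0 <= B)%R &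
  forall xi, sector k xi -> \int[nu]_eta ((D xi eta) ^+ 2)%:E <= B%:E.
Proof.
have [m mE] := nu_product.
have [p [sp DE]] := duality_site_product D_factor.
pose f j n : R := ((p j).[n%:R] ^+ 2)%R.
pose al j := \int[m]_n (f j n)%:E.
have al0 j : 0 <= al j by apply: integral_ge0 => n _; rewrite lee_fin sqr_ge0.
have momentE s : \int[nu]_eta ((D (conf_seq s) eta) ^+ 2)%:E =
    \prod_(x <- undup s) al (count_mem x s).
  have := @expect_prod_occupation _ _ nu m mE (undup s) [::] (fun=> setT)
    (fun x => f (count_mem x s)).
  rewrite cats0 undup_uniq big_nil mule1 => <- //; last by move=> x n; exact: sqr_ge0.
  apply: eq_integral => eta _; congr EFin.
  rewrite indicE mem_set// mulr1 (DE (undup s)) ?undup_uniq//; last first.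
    by move=> x; rewrite mem_undup => /count_memPn.
  by rewrite /site_product -prodrXl.
(* al j is the second moment for j particles on one site *)
have alfin j : (0 < j)%N -> al j < +oo.
  move=> j0; have := second_moment_lty (conf_seq_finite (nseq j (0%R : site d))).
  by rewrite momentE undup_nseq// big_seq1 count_nseq/= eqxx mul1n.
have alE j : (0 < j)%N -> al j = (fine (al j))%:E.
  by move=> j0; rewrite fineK// ge0_fin_numE// alfin.
pose B := (1 + \sum_(j < k.+1) fine (al j))%R.
have fal0 j : (0 <= fine (al j))%R by exact: fine_ge0.
have B1 : (1 <= B)%R by rewrite /B lerDl sumr_ge0.
exists (B ^+ k)%R; first by rewrite exprn_ge0// (le_trans _ B1).
move=> xi /sectorP[s <- sk]; rewrite momentE.
rewrite (eq_big_seq (fun x => (fine (al (count_mem x s)))%:E)); last first.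
  by move=> x; rewrite mem_undup -has_pred1 has_count => /alE.
rewrite prodEFin lee_fin.
apply: (@le_trans _ _ (\prod_(x <- undup s) B)%R).
  apply: ler_prod => x _; rewrite fal0/=.
  have xk : (count_mem x s < k.+1)%N by rewrite ltnS -sk count_size.
  rewrite /B (bigD1 (Ordinal xk))//= addrCA lerDl addr_ge0//.
  exact: sumr_ge0.
rewrite big_const_seq count_predT iter_mulr_1.
by rewrite ler_weXn2l// -sk size_undup.
Qed.

End second_moment.

(** * Two-point correlations of the duality functions *)

Section correlations.
Context {R : realType} {d : nat} {Omega0 : set (conf d)}
  {P : R -> R.-pker (conf d) ~> (conf d)} {nu : probability (conf d) R}
  {dW : measure_display} {W : measurableType dW} {Pr : probability W R}
  {eta : R -> W -> conf d} {D : conf d -> conf d -> R}.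
Hypotheses (systemP : is_particle_system Omega0 P)
  (nu_product : homogeneous_product nu)
  (nu_stationary : stationary Omega0 P nu)
  (eta_process : is_markov_process Omega0 P nu Pr eta)
  (D_osd : orthogonal_self_duality Omega0 P nu D).
Local Open Scope ereal_scope.

Let D_duality := osd_duality D_osd.
Let D_factor := osd_factorized D_osd.
Let D_orth := osd_orthogonal D_osd.

Let past_preimage (s : R) A : (0 <= s)%R -> measurable A -> past eta s (eta s @^-1` A).
Proof.
by move=> s0 mA; apply: sub_sigma_algebra; exists s, A; split=> //; rewrite s0 lexx.
Qed.

Lemma stationary_law (s : R) A : (0 <= s)%R -> measurable A ->
  Pr (eta s @^-1` A) = nu A.
Proof.
move=> s0 mA; have mO := ps_measurable systemP.
have m0 := mp_measurable eta_process (lexx 0%R).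
have := mp_markov eta_process (lexx 0%R) s0 (past_preimage (lexx 0%R) measurableT) mA.
rewrite add0r preimage_setT !setTI => ->.
rewrite -(proj2 nu_stationary s A s0 mA).
pose law0 : {measure set (conf d) -> \bar R} :=
  measure_function_pushforward__canonical__measure_function_Measure Pr m0.
rewrite (eq_measure_integral law0); last first.
  by move=> B mB _; exact/esym/(mp_initial eta_process mB).
by rewrite (ge0_integral_pushforward m0 Pr mO)//; apply: measurable_funTS;
  exact: (measurable_kernel (P s)).
Qed.

Lemma ge0_integral_stationary (s : R) (g : conf d -> \bar R) : (0 <= s)%R ->
  measurable_fun setT g -> (forall z, 0 <= g z) ->
  \int[Pr]_w g (eta s w) = \int[nu]_z g z.
Proof.
move=> s0 mg g0; have ms := mp_measurable eta_process s0.
pose laws : {measure set (conf d) -> \bar R} :=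
  measure_function_pushforward__canonical__measure_function_Measure Pr ms.
rewrite (eq_measure_integral laws); last first.
  by move=> B mB _; exact/esym/stationary_law.
by rewrite (ge0_integral_pushforward ms Pr measurableT).
Qed.

Lemma duality_product_integrable xi xi' (s s' : R) : (0 <= s)%R -> (0 <= s')%R ->
  finite_conf xi -> finite_conf xi' ->
  Pr.-integrable setT (fun w => (D xi (eta s w) * D xi' (eta s' w))%:E).
Proof.
move=> s0 s'0 fxi fxi'.
have mD r z : (0 <= r)%R -> finite_conf z -> measurable_fun setT (fun w => D z (eta r w)).
  move=> r0 fz; apply: measurableT_comp (mp_measurable eta_process r0).
  exact: measurable_duality.
have isq r z : (0 <= r)%R -> finite_conf z ->
    Pr.-integrable setT (fun w => (D z (eta r w) ^+ 2)%:E).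
  move=> r0 fz; apply/integrableP; split.
    by apply/measurable_EFinP/measurable_funX; exact: mD.
  under eq_integral => w _ do rewrite gee0_abs ?lee_fin ?sqr_ge0//.
  rewrite (ge0_integral_stationary (g := fun e => (D z e ^+ 2)%:E))//.
  - exact: (second_moment_lty D_orth).
  - by apply/measurable_EFinP/measurable_funX; exact: measurable_duality.
  - by move=> e; rewrite lee_fin sqr_ge0.
apply: (le_integrable measurableT _ _ (integrableD measurableT (isq s xi s0 fxi)
  (isq s' xi' s'0 fxi'))).
  by apply/measurable_EFinP/measurable_funM; exact: mD.
move=> w _; rewrite /= lee_fin [leRHS]ger0_norm ?addr_ge0 ?sqr_ge0//.
exact: normM_le_sqrD.
Qed.

(** Measurability of each [D xi] extends to the pair, because the sector is
    countable. *)
Lemma measurable_duality_joint k :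
  measurable_fun setT (fun z : conf d * conf d => D z.2 z.1 * \1_(sector k) z.2)%R.
Proof.
(* E n.+1 fixes the finite configuration; E 0 covers the complement of the sector *)
pose e (n : nat) : conf d := conf_seq (odflt [::] (unpickle n)).
pose E n := if n is n'.+1 then [set: conf d] `*` [set e n'] else setT `*` ~` sector k.
have mE n : measurable (E n).
  case: n => [|n]; apply: measurableX => //; last exact: measurable_conf1.
  by apply: measurableC; exact: measurable_sector.
have <- : \bigcup_n E n = setT.
  apply/seteqP; split => // -[x xi] _; have [/sectorP[s <- _]|ns] := pselect (sector k xi).
    by exists (pickle s).+1 => //=; split => //=; rewrite /e pickleK.
  by exists 0%N.
have [_ mcup] := @measurable_fun_bigcup _ _ _ _ E
  (fun z : conf d * conf d => D z.2 z.1 * \1_(sector k) z.2)%R mE.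
apply: mcup => -[|n].
  apply: (eq_measurable_fun (fun _ : conf d * conf d => 0%R : R)); last exact: measurable_cst.
  by move=> -[x xi]; rewrite inE => -[_ /= ns]; rewrite indicE memNset// mulr0.
apply: (eq_measurable_fun (fun z : conf d * conf d => D (e n) z.1 * \1_(sector k) (e n))%R).
  by move=> -[x xi]; rewrite inE => -[_ /= ->].
apply: measurable_funTS; apply: measurable_funM; last exact: measurable_cst.
apply: measurableT_comp; last exact: measurable_fst.
exact: (measurable_duality D_factor (conf_seq_finite _)).
Qed.

Lemma duality_product_integral xi xi' : finite_conf xi -> finite_conf xi' ->
  \int[nu]_e (D xi e * D xi' e)%:E =
  (xi == xi')%:R%:E * \int[nu]_e (D xi e ^+ 2)%:E.
Proof.
move=> fxi fxi'; have [_ orth] := D_orth; rewrite orth//.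
under eq_integral => e _ do rewrite expr2.
by rewrite orth// eqxx mul1e.
Qed.

(** Self-duality turns the two-time correlation into an average over [P r xi] of
    correlations at a single time, of which orthogonality keeps one. The average is
    carried by [sector k], where the second moments are bounded; this gives Fubini's
    theorem. *)
Lemma two_time_correlation k xi xi0 (s r : R) : (0 <= s)%R -> (0 <= r)%R ->
  sector k xi -> sector k xi0 ->
  \int[Pr]_w (D xi0 (eta s w) * D xi (eta (s + r) w))%:E =
  P r xi [set xi0] * \int[nu]_e (D xi0 e ^+ 2)%:E.
Proof.
move=> s0 r0 sxi sxi0; have [fxi mxi] := sxi; have [fxi0 _] := sxi0.
have mO := ps_measurable systemP; have nuO := proj1 nu_stationary.
pose h (z : conf d * conf d) := (D xi0 z.1 * D xi z.2)%:E.
have mh : measurable_fun setT h.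
  apply/measurable_EFinP/measurable_funM; apply: measurableT_comp.
  - exact: measurable_duality.
  - exact: measurable_fst.
  - exact: measurable_duality.
  - exact: measurable_snd.
have sr0 : (0 <= s + r)%R by rewrite addr_ge0.
have [B B0 hB] := second_moment_bounded nu_product D_factor D_orth k.
have full : P r xi (sector k) = 1.
  by have := ps_conservation systemP r0 fxi; rewrite mxi.
pose ka : subprobability (conf d) R := kernel_law (P r) xi.
have fullka : ka (sector k) = 1 by [].
have kaT : ka setT = 1 by exact: prob_kernel.
pose Dk (x xi' : conf d) : R := (D xi' x * \1_(sector k) xi')%R.
pose H (z : conf d * conf d) := (D xi0 z.1 * Dk z.1 z.2)%:E.
have mH : measurable_fun setT H.
  apply/measurable_EFinP/measurable_funM; last exact: measurable_duality_joint.
  by apply: measurableT_comp; [exact: measurable_duality|exact: measurable_fst].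
have iH : (nu \x ka).-integrable setT H.
  have [_] := @integrable21ltyP _ _ (conf d) (conf d) R nu ka H mH; apply.
  apply: (@le_lt_trans _ _ (\int[ka]_y (B + B)%:E)); last first.
    rewrite integral_cst// [X in _ * X](_ : _ = 1); first by rewrite mule1 ltry.
    exact: (prob_kernel (s := P r)).
  apply: ge0_le_integral => //.
  - by move=> y _; exact: integral_ge0.
  - apply: (measurable_fun_fubini_tonelli_G (m1 := nu) (abse \o H)).
      exact: measurableT_comp.
    by move=> y; exact: abse_ge0.
  - move=> y _; have [sy|sy] := pselect (sector k y); last first.
      rewrite integral0_eq ?lee_fin ?addr_ge0// => x _.
      by rewrite /H /Dk /= indicE memNset// !mulr0 normr0.
    have [fy _] := sy.
    have HE x : H (x, y) = (D xi0 x * D y x)%:E.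
      by rewrite /H /Dk /= indicE mem_set// mulr1.
    under eq_integral => x _ do rewrite HE.
    apply: (@le_trans _ _ (\int[nu]_x ((D xi0 x ^+ 2)%:E + (D y x ^+ 2)%:E))).
      apply: ge0_le_integral => //.
      + apply: measurableT_comp => //.
        by apply/measurable_EFinP/measurable_funM; exact: measurable_duality.
      + by apply: emeasurable_funD; apply/measurable_EFinP/measurable_funX;
          exact: measurable_duality.
      + move=> x _; rewrite -EFinD lee_fin.
        exact: normM_le_sqrD.
    rewrite ge0_integralD//.
    + by rewrite EFinD leeD ?hB.
    + by move=> x _; rewrite lee_fin sqr_ge0.
    + by apply/measurable_EFinP/measurable_funX; exact: measurable_duality.
    + by move=> x _; rewrite lee_fin sqr_ge0.
    + by apply/measurable_EFinP/measurable_funX; apply: measurable_duality => //; case: sy.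
(* the Markov property, then duality at a fixed environment x, then Fubini *)
rewrite (@integral_two_times _ _ _ _ _ _ _ (P r) nu Pr Omega0 (eta s) (eta (s + r))
  mO nuO _ _ _ _ h mh); last 5 first.
- exact: (mp_measurable eta_process s0).
- exact: (mp_measurable eta_process sr0).
- by move=> A; exact: stationary_law.
- move=> A A' mA mA'; apply: (mp_markov eta_process s0 r0 _ mA').
  exact: past_preimage.
- exact: duality_product_integrable.
transitivity (\int[nu]_x \int[ka]_y H (x, y)).
  apply: (ae_full_integral mO (probability_setT nu) nuO).
  - exact: measurable_integral_graph.
  - exact: (measurable_fubini_F iH).
  - move=> x; rewrite inE => Ox.
    have [i1 i2 e12] := D_duality r0 fxi Ox.
    rewrite /h /=; under eq_integral => y _ do rewrite EFinM.
    rewrite integralZl// e12.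
    have mDk : measurable_fun setT (fun y => (Dk x y)%:E).
      apply/measurable_EFinP.
      exact: (measurableT_comp (@measurable_duality_joint k) (measurable_pair1 x)).
    have i2' := i2.
    rewrite (integrable_mkcond _ measurable_finite_conf) in i2'.
    have iDk : ka.-integrable setT (fun y => (Dk x y)%:E).
      apply: (le_integrable measurableT mDk _ i2') => y _; rewrite patchE /Dk.
      have [sy|sy] := pselect (sector k y).
        by rewrite indicE !mem_set// ?mulr1//; case: sy.
      by rewrite indicE memNset// mulr0 abse0 abse_ge0.
    transitivity ((D xi0 x)%:E * \int[ka]_y (Dk x y)%:E).
      congr (_ * _); rewrite integral_mkcond.
      apply: (ae_full_integral (measurable_sector k) (prob_kernel _) full) => //.
        exact: (measurable_int (P r xi) i2').
      move=> y; rewrite inE => sy; rewrite patchE mem_set; last by case: sy.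
      by rewrite /Dk indicE mem_set// mulr1.
    by rewrite -integralZl//; apply: eq_integral => y _; rewrite -EFinM.
rewrite (Fubini iH).
have a0 : 0 <= \int[nu]_e (D xi0 e ^+ 2)%:E.
  by apply: integral_ge0 => e _; rewrite lee_fin sqr_ge0.
transitivity (\int[ka]_y ((\1_[set xi0] y)%:E * \int[nu]_e (D xi0 e ^+ 2)%:E)).
  apply: eq_integral => y _; rewrite /H /Dk /=.
  have [sy|sy] := pselect (sector k y).
    under eq_integral => x _ do rewrite indicE mem_set// mulr1.
    rewrite duality_product_integral//; last by case: sy.
    congr (_%:E * _); rewrite indicE; congr (_%:R); congr nat_of_bool.
    by apply/eqP/idP; rewrite inE /= => ->.
  rewrite integral0_eq => [|x _]; last by rewrite indicE memNset// !mulr0.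
  rewrite indicE memNset ?mul0e//= => yx; apply: sy; by rewrite yx.
rewrite ge0_integralZr//; last first.
  by apply/measurable_EFinP; apply: measurable_indic; exact: measurable_conf1.
by rewrite integral_indic ?setIT//; exact: measurable_conf1.
Qed.

End correlations.

(** * Sums over the lattice as series *)

Lemma site_enumeration d : (0 < d)%N ->
  exists e : nat -> site d, set_bij setT setT e.
Proof.
move=> d0; have inf : infinite_set [set: site d].
  apply/infiniteP.
  pose f (n : nat) : site d := const_mx n%:Z.
  have finj : {in [set: nat] &, injective f}.
    by move=> m n _ _ /matrixP/(_ 0 (Ordinal d0)); rewrite !mxE => -[].
  rewrite -(card_le_eql (inj_card_eq finj)); exact: subset_card_le.
pose U : pointedType := HB.pack (site d) (isPointed.Build (site d) 0).
apply/(@card_set_bijP nat U setT setT); rewrite card_eq_sym.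
exact: (eq_card_nat (countableP [set: site d]) inf).
Qed.

Section lattice_sums.
Context {R : realType} {d : nat} (e : nat -> site d).
Hypothesis bij_e : set_bij setT setT e.

Lemma esum_enumerated (a : site d -> \bar R) : (forall z, 0 <= a z)%E ->
  (\esum_(z in [set: site d]) a z = \sum_(i <oo) a (e i))%E.
Proof. by move=> a0; rewrite (reindex_esum _ _ _ _ bij_e) nneseries_esumT. Qed.

Lemma nneseries_cvg_fine (u : nat -> R) : (forall i, 0 <= u i) ->
  (\sum_(i <oo) (u i)%:E < +oo)%E ->
  (fun n => \sum_(i < n) u i) @ \oo --> fine (\sum_(i <oo) (u i)%:E)%E.
Proof.
move=> u0 uoo; have u0' i : (0 <= (u i)%:E)%E by rewrite lee_fin.
have sfin : (\sum_(i <oo) (u i)%:E)%E \is a fin_num.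
  by rewrite ge0_fin_numE// nneseries_ge0.
have cu := @is_cvg_nneseries R (fun i => (u i)%:E) xpredT 0 (fun i _ _ => u0' i).
have : (fun n => \sum_(0 <= i < n) (u i)%:E)%E @ \oo -->
    (fine (\sum_(i <oo) (u i)%:E)%E)%:E by rewrite fineK.
move=> /fine_cvg; apply: cvg_trans; apply: near_eq_cvg; near=> n.
by rewrite /= sumEFin/= big_mkord.
Unshelve. all: by end_near. Qed.

Lemma lattice_sum_cvg (f : site d -> R) : (\sum_(i <oo) `|f (e i)|%:E < +oo)%E ->
  (fun n => \sum_(i < n) f (e i)) @ \oo --> lattice_sum f.
Proof.
move=> foo; rewrite /lattice_sum !esum_enumerated; last 2 first.
- by move=> z; rewrite lee_fin le_max lexx orbT.
- by move=> z; rewrite lee_fin le_max lexx orbT.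
have part (g : R -> R) : (forall x, 0 <= g x <= `|x|) ->
    (\sum_(i <oo) (g (f (e i)))%:E < +oo)%E.
  move=> hg; apply: le_lt_trans foo; apply: lee_nneseries => i _.
    by rewrite lee_fin; have /andP[] := hg (f (e i)).
  by rewrite lee_fin; have /andP[] := hg (f (e i)).
have p1 := part (fun x => Num.max x 0).
have p2 := part (fun x => Num.max (- x) 0).
have {}p1 : (\sum_(i <oo) (Num.max (f (e i)) 0)%:E < +oo)%E.
  by apply: p1 => x; rewrite le_max lexx orbT ge_max ler_norm normr_ge0.
have {}p2 : (\sum_(i <oo) (Num.max (- f (e i)) 0)%:E < +oo)%E.
  by apply: p2 => x; rewrite le_max lexx orbT ge_max -normrN ler_norm normr_ge0.
have m0 (x : R) : 0 <= Num.max x 0 by rewrite le_max lexx orbT.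
rewrite fineB; last 2 first.
- by rewrite ge0_fin_numE// nneseries_ge0// => i _ _; rewrite lee_fin.
- by rewrite ge0_fin_numE// nneseries_ge0// => i _ _; rewrite lee_fin.
have -> : (fun n => \sum_(i < n) f (e i)) = (fun n =>
    \sum_(i < n) Num.max (f (e i)) 0 - \sum_(i < n) Num.max (- f (e i)) 0).
  apply/funext => n; rewrite -sumrB; apply: eq_bigr => i _.
  by case: (leP (f (e i)) 0) => h; case: (leP (- f (e i)) 0) => h'; lra.
by apply: cvgB; apply: nneseries_cvg_fine.
Qed.

Lemma measurable_lattice_sum (dT : measure_display) (T : measurableType dT)
    (f : site d -> T -> R) : (forall z, measurable_fun setT (f z)) ->
  measurable_fun setT (fun x => lattice_sum (f ^~ x)).
Proof.
move=> mf; have m0 (x : R) : (0 <= (Num.max x 0)%:E)%E.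
  by rewrite lee_fin le_max lexx orbT.
under eq_fun => x do rewrite /lattice_sum !esum_enumerated//.
apply: (measurableT_comp (f := fine)) => //.
apply: emeasurable_funB; apply: ge0_emeasurable_sum => // i _;
  apply/measurable_EFinP; apply: measurable_maxr => //.
exact: measurableT_comp.
Qed.

End lattice_sums.

(** * Covariance of the fluctuation field *)

Lemma conf_of_shift d k (z : site d) (x : 'I_k -> site d) :
  conf_of (shift_points z x) = conf_seq [seq z + y | y <- [seq x i | i <- enum 'I_k]].
Proof.
apply/funext => y; rewrite /conf_of /conf_seq 2!count_map -sum1_count [RHS]big_mkcond.
rewrite [RHS]big_enum/=; by apply: eq_bigr => i _; rewrite /shift_points; case: (_ == _).
Qed.

Lemma sector_shift d k (z : site d) (x : 'I_k -> site d) :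
  sector k (conf_of (shift_points z x)).
Proof.
apply/sectorP; rewrite conf_of_shift; eexists; first by [].
by rewrite 2!size_map size_enum_ord.
Qed.

Lemma weighted_cauchy_schwarz (R : realFieldType) (n : nat) (a b : 'I_n -> R) :
  (\sum_(i < n) a i * b i) ^+ 2 <=
  (\sum_(i < n) `|a i|) * \sum_(i < n) `|a i| * b i ^+ 2.
Proof.
set A := \sum_(i < n) `|a i|; set Q := \sum_(i < n) `|a i| * b i ^+ 2.
have e1 : A * Q = \sum_(i < n) \sum_(j < n) `|a i| * `|a j| * b j ^+ 2.
  rewrite /A /Q mulr_suml; apply: eq_bigr => i _; rewrite [LHS]mulr_sumr.
  by apply: eq_bigr => j _; rewrite mulrA.
have e2 : A * Q = \sum_(i < n) \sum_(j < n) `|a i| * `|a j| * b i ^+ 2.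
  rewrite e1 exchange_big/=; apply: eq_bigr => i _; apply: eq_bigr => j _; ring.
have e3 : (\sum_(i < n) a i * b i) ^+ 2 =
    \sum_(i < n) \sum_(j < n) a i * a j * (b i * b j).
  rewrite expr2 mulr_suml; apply: eq_bigr => i _; rewrite [LHS]mulr_sumr.
  by apply: eq_bigr => j _; ring.
have : (\sum_(i < n) a i * b i) ^+ 2 + (\sum_(i < n) a i * b i) ^+ 2 <= A * Q + A * Q.
  rewrite {1}e1 e2 e3 -!big_split/=; apply: ler_sum => i _.
  rewrite -!big_split/=; apply: ler_sum => j _.
  rewrite -[leLHS]mulrDr -[leRHS]mulrDr -normrM; set c := a i * a j.
  apply: (@le_trans _ _ (`|c| * `|b i * b j + b i * b j|)).
    by rewrite -normrM ler_norm.
  rewrite ler_wpM2l// ler_norml; have := sqr_ge0 (b i - b j).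
  by have := sqr_ge0 (b i + b j); rewrite !expr2; lra.
lra.
Qed.

Section field.
Context {R : realType} {d : nat} {Omega0 : set (conf d)}
  {P : R -> R.-pker (conf d) ~> (conf d)} {nu : probability (conf d) R}
  {dW : measure_display} {W : measurableType dW} {Pr : probability W R}
  {eta : R -> W -> conf d} {D : conf d -> conf d -> R}.
Hypotheses (systemP : is_particle_system Omega0 P)
  (nu_product : homogeneous_product nu)
  (nu_stationary : stationary Omega0 P nu)
  (eta_process : is_markov_process Omega0 P nu Pr eta)
  (D_osd : orthogonal_self_duality Omega0 P nu D).
Variables (e : nat -> site d) (bij_e : set_bij setT setT e).
Variables (k : nat) (x : 'I_k -> site d) (c : site d -> R) (A : R).
Hypothesis sum_c : forall n, \sum_(i < n) `|c (e i)| <= A.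

Let D_factor := osd_factorized D_osd.
Let D_orth := osd_orthogonal D_osd.
Let Dz (z : site d) := D (conf_of (shift_points z x)).
Let X (zeta : conf d) := lattice_sum (fun z => c z * Dz z zeta).
Let X_ n (zeta : conf d) := \sum_(i < n) c (e i) * Dz (e i) zeta.
(** By the Cauchy-Schwarz inequality [A * U] dominates the square of every partial
    sum [X_ n] of the field. *)
Let U (zeta : conf d) := (\sum_(i <oo) (`|c (e i)| * Dz (e i) zeta ^+ 2)%:E)%E.

Let mDz z : measurable_fun setT (Dz z).
Proof. by apply: measurable_duality => //; case: (sector_shift z x). Qed.

Let A0 : 0 <= A.
Proof. by have := sum_c 0; rewrite big_ord0. Qed.

Let mX : measurable_fun setT X.
Proof.
apply: (measurable_lattice_sum bij_e) => z.
by apply: measurable_funM => //; exact: measurable_cst.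
Qed.

Let mX_ n : measurable_fun setT (X_ n).
Proof.
by apply: measurable_sum => i; apply: measurable_funM => //; exact: measurable_cst.
Qed.

Let u0 i zeta : (0 <= (`|c (e i)| * Dz (e i) zeta ^+ 2)%:E)%E.
Proof. by rewrite lee_fin mulr_ge0// sqr_ge0. Qed.

Let mu_ i : measurable_fun setT (fun zeta => (`|c (e i)| * Dz (e i) zeta ^+ 2)%:E).
Proof.
apply/measurable_EFinP/measurable_funM; first exact: measurable_cst.
exact: measurable_funX.
Qed.

Let mU : measurable_fun setT U.
Proof. by apply: ge0_emeasurable_sum. Qed.

Let U0 zeta : (0 <= U zeta)%E.
Proof. exact: nneseries_ge0. Qed.

Let sum_c_series : (\sum_(i <oo) `|c (e i)|%:E <= A%:E)%E.
Proof.
apply: lime_le; first by apply: is_cvg_nneseries => i _ _; rewrite lee_fin.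
by apply: nearW => n; rewrite sumEFin lee_fin big_mkord.
Qed.

Let integral_U_lty : (\int[nu]_zeta U zeta < +oo)%E.
Proof.
have [B B0 hB] := second_moment_bounded nu_product D_factor D_orth k.
rewrite integral_nneseries//.
apply: (@le_lt_trans _ _ (\sum_(i <oo) B%:E * `|c (e i)|%:E)%E).
  apply: lee_nneseries => i _; first by move=> *; apply: integral_ge0 => zeta _; exact: u0.
  under eq_integral => zeta _ do rewrite EFinM.
  rewrite ge0_integralZl_EFin//; last 2 first.
  - by move=> zeta _; rewrite lee_fin sqr_ge0.
  - by apply/measurable_EFinP; exact: measurable_funX.
  by rewrite muleC lee_wpmul2r ?lee_fin// hB//; exact: sector_shift.
rewrite nneseriesZl; last by move=> i _; rewrite lee_fin.
apply: (@le_lt_trans _ _ (B%:E * A%:E)%E); last by rewrite -EFinM ltry.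
by rewrite lee_wpmul2l// lee_fin.
Qed.

Let X_sq_le n zeta : ((X_ n zeta ^+ 2)%:E <= A%:E * U zeta)%E.
Proof.
apply: (@le_trans _ _ (A * \sum_(i < n) `|c (e i)| * Dz (e i) zeta ^+ 2)%:E).
  rewrite lee_fin; apply: le_trans (weighted_cauchy_schwarz _ _) _.
  by rewrite ler_wpM2r ?sum_c// sumr_ge0// => i _; rewrite mulr_ge0// sqr_ge0.
rewrite EFinM lee_wpmul2l ?lee_fin//.
have := @nneseries_lim_ge R (fun i => (`|c (e i)| * Dz (e i) zeta ^+ 2)%:E) xpredT 0 n
  (fun i _ _ => u0 i zeta).
by rewrite sumEFin big_mkord.
Qed.

Let X_cvg zeta : (U zeta < +oo)%E -> (fun n => X_ n zeta) @ \oo --> X zeta.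
Proof.
move=> Uoo; apply: (lattice_sum_cvg bij_e).
apply: (@le_lt_trans _ _ (\sum_(i <oo) (`|c (e i)|%:E + (`|c (e i)| * Dz (e i) zeta ^+ 2)%:E))%E).
  apply: lee_nneseries => i _; first by rewrite lee_fin.
  rewrite -EFinD lee_fin normrM -{2}[ `|c (e i)|]mulr1 -mulrDr ler_wpM2l//.
  rewrite -(real_normK (num_real (Dz _ _))).
  by have := sqr_ge0 (`|Dz (e i) zeta| - 1); have := normr_ge0 (Dz (e i) zeta); nra.
rewrite nneseriesD => [|i _ _|i _ _]; [|by rewrite lee_fin|exact: u0].
apply: lte_add_pinfty => //.
by apply: le_lt_trans sum_c_series _; exact: ltry.
Qed.

Let U_integrable s : 0 <= s -> Pr.-integrable setT (fun w => U (eta s w)).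
Proof.
move=> s0; apply/integrableP; split.
  exact: measurableT_comp mU (mp_measurable eta_process s0).
under eq_integral => w _ do rewrite gee0_abs//.
by rewrite (ge0_integral_stationary systemP nu_stationary eta_process s0 mU U0).
Qed.

(** The field is square integrable, so its covariance is the limit of the
    covariances of its partial sums. *)
Lemma field_covariance_le (t s K : R) : 0 <= t -> 0 <= s ->
  (forall n, \sum_(i < n) \sum_(j < n) `|c (e i)| * `|c (e j)| *
     `|fine (\int[Pr]_w (Dz (e i) (eta t w) * Dz (e j) (eta s w))%:E)%E| <= K) ->
  (\int[Pr]_w (X (eta t w) * X (eta s w))%:E <= K%:E)%E.
Proof.
move=> t0 s0 hK.
have mt := mp_measurable eta_process t0; have ms := mp_measurable eta_process s0.
pose f n w := (X_ n (eta t w) * X_ n (eta s w))%:E.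
pose g w := (A%:E * U (eta t w) + A%:E * U (eta s w))%E.
have [] := @dominated_convergence _ _ _ Pr setT measurableT f
  (fun w => (X (eta t w) * X (eta s w))%:E) g.
- by move=> n; apply/measurable_EFinP/measurable_funM;
    apply: measurableT_comp => //; exact: mX_.
- by apply/measurable_EFinP/measurable_funM; apply: measurableT_comp => //; exact: mX.
- have := integrable_ae measurableT (U_integrable s0).
  have := integrable_ae measurableT (U_integrable t0).
  apply: filterS2 => w /(_ Logic.I) ut /(_ Logic.I) us _.
  apply: cvg_EFin; first exact: nearW.
  by apply: cvgM; apply: X_cvg; rewrite -ge0_fin_numE.
- by apply: integrableD => //; apply: integrableZl => //; exact: U_integrable.
- apply: aeW => w n _; apply: (@le_trans _ _ ((X_ n (eta t w) ^+ 2)%:E + (X_ n (eta s w) ^+ 2)%:E)%E).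
    by rewrite -EFinD lee_fin normM_le_sqrD.
  by rewrite leeD.
move=> _ _ lim_f; apply: (cvge_le _ lim_f); apply: nearW => n.
have iD i j := duality_product_integrable systemP nu_stationary eta_process D_osd t0 s0
  (proj1 (sector_shift (e i) x)) (proj1 (sector_shift (e j) x)).
rewrite [leLHS](_ : _ = \sum_(i < n) \sum_(j < n) (c (e i) * c (e j))%:E *
    \int[Pr]_w (Dz (e i) (eta t w) * Dz (e j) (eta s w))%:E)%E; last first.
  transitivity (\int[Pr]_w \sum_(i < n) \sum_(j < n) (c (e i) * c (e j))%:E *
     (Dz (e i) (eta t w) * Dz (e j) (eta s w))%:E)%E.
    apply: eq_integral => w _; rewrite /f /X_ mulr_suml -sumEFin.
    apply: eq_bigr => i _; rewrite mulr_sumr -sumEFin; apply: eq_bigr => j _.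
    by rewrite -EFinM; congr EFin; ring.
  rewrite integral_sum//; last first.
    by move=> i; apply: integrable_sum => // j _; exact: (integrableZl measurableT _ (iD i j)).
  apply: eq_bigr => i _; rewrite integral_sum//; last first.
    by move=> j; exact: (integrableZl measurableT _ (iD i j)).
  by apply: eq_bigr => j _; rewrite (integralZl measurableT (iD i j)).
rewrite (eq_bigr (fun i : 'I_n => (\sum_(j < n) c (e i) * c (e j) *
  fine (\int[Pr]_w (Dz (e i) (eta t w) * Dz (e j) (eta s w))%:E)%E)%:E)); last first.
  move=> i _; rewrite -sumEFin; apply: eq_bigr => j _; rewrite [in RHS]EFinM fineK//.
  exact: (integrable_fin_num measurableT (iD i j)).
rewrite sumEFin lee_fin; apply: le_trans (hK n).
apply: ler_sum => i _; apply: ler_sum => j _.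
by rewrite -!normrM ler_norm.
Qed.

End field.

(** * Time integrals *)

(** The integral of the positive part is a supremum over the simple functions below
    it, hence monotone among arbitrary functions. The time integrands below are known
    through their majorants only. *)
Lemma le_integral_majorant (dT : measure_display) (T : measurableType dT)
    (R : realType) (mu : {measure set T -> \bar R}) (A : set T) (f g : T -> \bar R) :
  (forall x, A x -> 0 <= g x)%E -> (forall x, A x -> f x <= g x)%E ->
  (\int[mu]_(x in A) f x <= \int[mu]_(x in A) g x)%E.
Proof.
move=> g0 fg; rewrite integralE.
apply: (@le_trans _ _ (\int[mu]_(x in A) f^\+ x)%E).
  rewrite -[leRHS]sube0 leeB//; apply: integral_ge0 => x _; exact: funeneg_ge0.
rewrite !ge0_integralE//.
apply: le_ereal_sup => _ [h /= hf <-]; exists h => //= x.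
apply: le_trans (hf x) _; rewrite !patchE; case: ifPn => // /set_mem Ax.
by rewrite funeposE ge_max fg// g0.
Qed.

Section power_integral.
Context {R : realType}.
Implicit Types (p c m u v : R).

Lemma is_derive_affine_powR p c m s : p != 0 -> m != 0 -> 0 < c + m * s ->
  is_derive s 1 (fun s => (m * p)^-1 * (c + m * s) `^ p) ((c + m * s) `^ (p - 1)).
Proof.
move=> p0 m0 cs.
have dg : is_derive s 1 (fun s : R => c + m * s) m.
  by apply: is_derive_eq; rewrite add0r mul1r /GRing.scale/= mulr1.
have df := @is_derive1_powR R p (c + m * s) cs.
have dfg := @is_derive1_comp _ (fun a : R => a `^ p) (fun s : R => c + m * s) s _ _ df dg.
have -> : (fun s => (m * p)^-1 * (c + m * s) `^ p) =
    (m * p)^-1 \*: ((fun a : R => a `^ p) \o (fun s : R => c + m * s)) by [].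
apply: is_derive_eq; rewrite /GRing.scale/=; field; exact/andP.
Qed.

Lemma integral_affine_powR p c m u v : p != 0 -> m != 0 -> u <= v ->
  (forall s, u <= s <= v -> 0 < c + m * s) ->
  (\int[lebesgue_measure]_(s in `[u, v]) ((c + m * s) `^ (p - 1))%:E =
   ((m * p)^-1 * (c + m * v) `^ p - (m * p)^-1 * (c + m * u) `^ p)%:E)%E.
Proof.
move=> p0 m0; rewrite le_eqVlt => /predU1P[<- _|uv pos].
  by rewrite set_itv1 integral_set1 subrr.
pose F s := (m * p)^-1 * (c + m * s) `^ p.
have dF s : u <= s <= v -> is_derive s 1 F ((c + m * s) `^ (p - 1)).
  by move=> /pos; exact: is_derive_affine_powR.
have cF s : u <= s <= v -> {for s, continuous F}.
  by move=> /dF ds; apply/differentiable_continuous/derivable1_diffP; exact: ex_derive.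
have cf s : u <= s <= v -> {for s, continuous (fun s => (c + m * s) `^ (p - 1))}.
  move=> /pos ps; apply/differentiable_continuous/derivable1_diffP.
  apply: (@ex_derive _ _ _ _ _ _ _).
  have dg : is_derive s 1 (fun s : R => c + m * s) m.
    by apply: is_derive_eq; rewrite add0r mul1r /GRing.scale/= mulr1.
  exact: (@is_derive1_comp _ (fun a : R => a `^ (p - 1)) (fun s : R => c + m * s) s _ _
    (is_derive1_powR (p - 1) ps) dg).
rewrite (@continuous_FTC2 _ _ F)//.
- apply/continuous_within_itvP => //; split.
  + by move=> s; rewrite in_itv/= => /andP[us sv]; apply: cf; rewrite !ltW.
  + by apply: cvg_at_right_filter; apply: cf; rewrite lexx ltW.
  + by apply: cvg_at_left_filter; apply: cf; rewrite lexx ltW.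
- split.
  + by move=> s; rewrite in_itv/= => /andP[us sv]; apply: ex_derive; apply: dF; rewrite !ltW.
  + by apply: cvg_at_right_filter; apply: cF; rewrite lexx ltW.
  + by apply: cvg_at_left_filter; apply: cF; rewrite lexx ltW.
- move=> s; rewrite in_itv/= => /andP[us sv]; rewrite derive1E.
  have ds : is_derive s 1 F ((c + m * s) `^ (p - 1)) by apply: dF; rewrite !ltW.
  exact: derive_val.
Qed.

Lemma measurable_decay (A : set R) (n t b : R) :
  measurable_fun A (fun s => ((1 + n * `|t - s|) `^ (- b))%:E).
Proof.
apply/measurable_EFinP; apply: measurable_funTS.
apply: (measurableT_comp (f := fun a : R => a `^ (- b))); first exact: measurable_powR.
apply: measurable_funD => //; apply: measurable_funM => //.
by apply: measurableT_comp => //; exact: measurable_funB.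
Qed.

(** On both sides of [t] the integrand is a power of an affine function of slope
    [n ^ 2] up to sign. The primitive gains the factor [n ^ (- 2)] and, as [b < 1], is
    at most of order [n ^ (2 (1 - b))] at the end points. *)
Lemma time_integral_le (T t b n : R) : 0 <= t <= T -> 0 <= b -> b < 1 -> 1 <= n ->
  (\int[lebesgue_measure]_(s in `[0%R, T]) ((1 + n ^+ 2 * `|t - s|) `^ (- b))%:E <=
   (2 * (1 + T) `^ (1 - b) / (1 - b) * n `^ (- (2 * b)))%:E)%E.
Proof.
move=> /andP[t0 tT] b0 b1 n1.
have n0 : 0 < n by lra.
pose p := 1 - b; have pb : p - 1 = - b by rewrite /p; ring.
have p0 : 0 < p by rewrite /p; lra.
have pn0 : p != 0 by rewrite gt_eqF.
have n2 : 0 < n ^+ 2 by rewrite exprn_gt0.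
have T0 : 0 <= T by lra.
pose M := (1 + n ^+ 2 * T) `^ p / (n ^+ 2 * p).
have MB : M + M <= 2 * (1 + T) `^ p / p * n `^ (- (2 * b)).
  have h : (1 + n ^+ 2 * T) `^ p <= (1 + T) `^ p * (n ^+ 2) `^ p.
    rewrite -powRM ?(ltW n2)//; last by lra.
    apply: ge0_ler_powR; rewrite ?nnegrE ?(ltW p0)//.
    - by rewrite addr_ge0// mulr_ge0// ltW.
    - by rewrite mulr_ge0// ltW//; lra.
    - have : 1 <= n ^+ 2 by exact: exprn_ege1.
      nra.
  have e : (n ^+ 2) `^ p = n ^+ 2 * n `^ (- (2 * b)).
    rewrite -(powR_mulrn 2 (ltW n0)) -powRrM -powRD; last first.
      by apply/implyP => _; rewrite gt_eqF.
    by congr (_ `^ _); rewrite /p; ring.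
  rewrite e in h.
  have -> : M + M = 2 * (1 + n ^+ 2 * T) `^ p / (n ^+ 2 * p)
    by rewrite /M; field; apply/andP; split; lra.
  rewrite ler_pdivrMr ?mulr_gt0//.
  apply: (@le_trans _ _ (2 * ((1 + T) `^ p * (n ^+ 2 * n `^ (- (2 * b)))))).
    by rewrite ler_pM2l.
  by rewrite le_eqVlt; apply/orP; left; apply/eqP; field; lra.
rewrite -/p; apply: (@le_trans _ _ (M + M)%:E); last by rewrite lee_fin.
have -> : [set` `[0, T]] = [set` `[0, t]] `|` [set` `]t, T]] :> set R.
  apply/seteqP; split => s /=; rewrite !in_itv/=.
    by move=> /andP[s0 sT]; case: (leP s t) => st; [left|right]; rewrite ?s0 ?sT.
  by case=> /andP[h1 h2]; apply/andP; split; lra.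
rewrite ge0_integral_setU//=; last 3 first.
- exact: measurable_decay.
- by move=> s _; rewrite lee_fin powR_ge0.
- apply: lt_disjoint => x y; rewrite !in_itv/= => /andP[_ xt] /andP[ty _].
  exact: le_lt_trans ty.
have half (c m u v : R) : m != 0 -> u <= v ->
    (forall s, u <= s <= v -> 0 < c + m * s) ->
    (forall s, u <= s <= v -> 1 + n ^+ 2 * `|t - s| = c + m * s) ->
    (\int[lebesgue_measure]_(s in `[u, v]) ((1 + n ^+ 2 * `|t - s|) `^ (- b))%:E <=
    ((m * p)^-1 * (c + m * v) `^ p - (m * p)^-1 * (c + m * u) `^ p)%:E)%E.
  move=> m0 uv pos eq_s; rewrite -(integral_affine_powR pn0 m0 uv pos).
  apply: le_integral_majorant => s; rewrite /= in_itv/= => /eq_s es.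
    by rewrite lee_fin powR_ge0.
  by rewrite es pb.
have mono x : 0 <= x <= T -> (1 + n ^+ 2 * x) `^ p <= (1 + n ^+ 2 * T) `^ p.
  move=> /andP[x0 xT]; apply: ge0_ler_powR; rewrite ?nnegrE ?(ltW p0)//.
  - by rewrite addr_ge0// mulr_ge0// ltW.
  - by rewrite addr_ge0// mulr_ge0// ltW.
  - by rewrite lerD2l ler_wpM2l// ltW.
have i0 : 0 <= (n ^+ 2 * p)^-1 by rewrite invr_ge0 mulr_ge0// ltW.
rewrite EFinD leeD//.
  apply: le_trans (half (1 + n ^+ 2 * t) (- n ^+ 2) 0 t _ _ _ _) _ => //.
  - by rewrite oppr_eq0 gt_eqF.
  - by move=> s /andP[s0 st]; nra.
  - by move=> s /andP[s0 st]; rewrite ger0_norm ?subr_ge0//; ring.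
  rewrite lee_fin mulr0 addr0 (_ : 1 + n ^+ 2 * t + - n ^+ 2 * t = 1); last by ring.
  rewrite powR1 /M mulNr invrN !mulNr opprK mulr1.
  have := mono t; rewrite t0 tT => /(_ isT) /(ler_wpM2l i0).
  rewrite [in leRHS]mulrC; lra.
rewrite integral_itv_obnd_cbnd; last exact: measurable_decay.
apply: le_trans (half (1 - n ^+ 2 * t) (n ^+ 2) t T _ _ _ _) _ => //.
- by rewrite gt_eqF.
- by move=> s /andP[s0 st]; nra.
- by move=> s /andP[ts sT]; rewrite ler0_norm ?subr_le0//; ring.
rewrite lee_fin (_ : 1 - n ^+ 2 * t + n ^+ 2 * t = 1); last by ring.
rewrite powR1 /M mulr1 (_ : 1 - n ^+ 2 * t + n ^+ 2 * T = 1 + n ^+ 2 * (T - t)); last by ring.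
have := mono (T - t); rewrite subr_ge0 tT lerBlDr lerDl t0 => /(_ isT) /(ler_wpM2l i0).
rewrite [in leRHS]mulrC; lra.
Qed.

End power_integral.

(** * Decay of the correlations and conclusion *)

(** With [m = k - 1]: the loss [a] and the decay [b] per particle that make the bounds
    below meet the exponent of the theorem. *)
Lemma decay_exponents (R : realFieldType) (d m : nat) : (0 < d)%N ->
  exists a b : R, [/\ 0 < a, 0 <= b <= d%:R / 2, b * m%:R < 1 &
    2 * m%:R * d%:R / (2 + m%:R * d%:R) <= m%:R * (2 * b - a)].
Proof.
move=> d0; have d1 : 1 <= d%:R :> R by rewrite ler1n.
case: m => [|m].
  exists 1, 0; rewrite lexx mulr0 mul0r !mul0r; split => //.
  by rewrite /= divr_ge0.
have m1 : 1 <= m.+1%:R :> R by rewrite ler1n.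
clear d0; move: (m.+1%:R : R) (d%:R : R) d1 m1 => {}m {}d d1 m1.
have md : 1 <= m * d by rewrite -[1]mulr1 ler_pM.
have p1 : 0 < 1 + m * d by lra.
have p2 : 0 < 2 + m * d by lra.
(* b m < 1 leaves b = d / (1 + m d) <= d / 2, and a is fixed by
   2 b - a = 2 d / (2 + m d) *)
exists (2 * d / ((1 + m * d) * (2 + m * d))), (d / (1 + m * d)); split.
- by rewrite divr_gt0 ?mulr_gt0//; lra.
- apply/andP; split; first by rewrite divr_ge0; lra.
  by rewrite ler_pM2l ?lef_pV2 ?posrE//; lra.
- by rewrite mulrAC ltr_pdivrMr// mul1r; lra.
- rewrite le_eqVlt; apply/orP; left; apply/eqP; field.
  by apply/andP; split; rewrite gt_eqF.
Qed.

Lemma kernel_fin_num (R : realType) (dT : measure_display) (T : measurableType dT)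
    (P : R.-pker T ~> T) x A : measurable A -> P x A \is a fin_num.
Proof.
move=> mA; rewrite ge0_fin_numE//; apply: (@le_lt_trans _ _ (P x setT)).
  by apply: le_measure; rewrite ?inE.
by rewrite prob_kernel ltry.
Qed.

Section decay.
Context {R : realType} {d : nat} {Omega0 : set (conf d)}
  {P : R -> R.-pker (conf d) ~> (conf d)} {D : conf d -> conf d -> R}.
Hypothesis systemP : is_particle_system Omega0 P.
Hypothesis D_duality : self_duality Omega0 P D.
Hypothesis D_factor : factorized_polynomials D.
Variable C : nat -> R.
Hypothesis heat_kernel_bound : forall (xi xi' : conf d) (t : R),
  finite_conf xi -> finite_conf xi' -> 0 <= t ->
  (transition_probability P t xi xi'
   <= (C (mass xi) / ((1 + t) `^ ((mass xi)%:R * d%:R / 2)))%:E)%E.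

(** The [k]-point bound summed over [ws] is [sum_transition_le] at the level
    [mu = n ^ a (1 + r) ^ (- b)]. The [M]-particle kernel decays like [mu ^ (M - 1)]
    without the factor [n ^ a], and for [M] large the gain [n ^ (a (M - 1))] outweighs
    the number [n ^ d] of translations; hence any [a > 0] is possible. *)
Lemma return_decay (k : nat) (a b B : R) : (0 < k)%N -> 0 < a -> 0 <= b <= d%:R / 2 ->
  0 <= B ->
  exists2 K : R, 0 <= K & forall (n r : R) (c : site d -> R) (s x0 ws : seq (site d)),
    1 <= n -> 0 <= r -> (forall w, 0 <= c w <= B) ->
    \sum_(w <- ws) c w <= B * n ^+ d -> uniq ws -> size s = k -> size x0 = k ->
    \sum_(w <- ws) c w *
      fine (P r (conf_seq s) [set conf_seq [seq w + x | x <- x0]]) <=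
    K * (n `^ a * (1 + r) `^ (- b)) ^+ k.-1.
Proof.
move=> k0 a0 /andP[b0 bd] B0.
pose M := (maxn k (Num.truncn (d%:R / a)).+2).
have kM : (k <= M)%N by rewrite leq_maxl.
have M0 : (0 < M)%N by exact: leq_trans kM.
have aM : d%:R <= a * M.-1%:R.
  rewrite mulrC -ler_pdivrMr//.
  apply: (@le_trans _ _ (Num.truncn (d%:R / a)).+1%:R); first exact/ltW/truncnS_gt.
  by rewrite ler_nat -ltnS prednK// leq_maxr.
pose C' := Num.max (C M) 0.
have C'0 : 0 <= C' by rewrite le_max lexx orbT.
pose Q : R := (M ^ M * M`!)%:R.
exists (k%:R ^+ k * k%:R * (B + Q * C' * B)).
  by rewrite mulr_ge0 ?addr_ge0 ?mulr_ge0 ?exprn_ge0.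
move=> n r c s x0 ws n1 r0 c0 sc uws sk x0k.
have n0 : 0 < n by lra.
have r1 : 1 <= 1 + r by lra.
have r1' : 0 < 1 + r by lra.
pose mu := n `^ a * (1 + r) `^ (- b).
have mu0 : 0 < mu by rewrite mulr_gt0// powR_gt0.
pose bM := C' / (1 + r) `^ (M%:R * d%:R / 2).
have pbM xi xi' : sector M xi -> sector M xi' ->
    fine (transition_probability P r xi xi') <= bM.
  move=> [fxi mxi] [fxi' _].
  have fin : transition_probability P r xi xi' \is a fin_num.
    by apply: kernel_fin_num; exact: measurable_conf1.
  rewrite -lee_fin fineK//; apply: le_trans (heat_kernel_bound fxi fxi' r0) _.
  by rewrite mxi lee_fin ler_wpM2r ?invr_ge0 ?powR_ge0// le_max lexx.
have sx : size s = size x0 by rewrite sk x0k.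
have := sum_transition_le systemP D_duality D_factor r0 (M := M) (cm := B) (b := bM)
  (mu := mu) uws c0 sx.
rewrite x0k => /(_ k0 kM mu0 pbM) /le_trans; apply.
rewrite -[leRHS]mulrA ler_wpM2l ?mulr_ge0 ?exprn_ge0//.
rewrite -/Q mulrDl lerD//.
have -> : mu ^+ k / mu ^+ M = mu ^+ k.-1 / mu ^+ M.-1.
  rewrite -{1}(prednK k0) -{1}(prednK M0) !exprS invfM mulrACA divff ?mul1r//.
  by rewrite gt_eqF.
(* the M-particle term is at most of the order of the first one *)
have key : n ^+ d <= (1 + r) `^ (M%:R * d%:R / 2) * mu ^+ M.-1.
  rewrite /mu exprMn -!powR_mulrn ?powR_ge0 ?(ltW n0)// -!powRrM mulrCA -powRD; last first.
    by apply/implyP => _; rewrite gt_eqF.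
  rewrite -[leLHS]mulr1 ler_pM ?powR_ge0//; first exact: ler_powR.
  rewrite -[leLHS](powRr0 (1 + r)); apply: ler_powR => //.
  have : b * M.-1%:R <= d%:R / 2 * M%:R by rewrite ler_pM// ler_nat leq_pred.
  by lra.
have q0 : 0 < (1 + r) `^ (M%:R * d%:R / 2) * mu ^+ M.-1.
  by rewrite mulr_gt0 ?powR_gt0 ?exprn_gt0.
have Q0 : 0 <= Q by [].
apply: (@le_trans _ _ (Q * (mu ^+ k.-1 / mu ^+ M.-1) * bM * (B * n ^+ d))).
  rewrite ler_wpM2l// !mulr_ge0 ?invr_ge0 ?exprn_ge0 ?powR_ge0 ?(ltW mu0)//.
have -> : Q * (mu ^+ k.-1 / mu ^+ M.-1) * bM * (B * n ^+ d) =
  (Q * C' * B * mu ^+ k.-1) * (n ^+ d / ((1 + r) `^ (M%:R * d%:R / 2) * mu ^+ M.-1)).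
  rewrite /bM; field; apply/andP; split; rewrite ?expf_neq0// gt_eqF// powR_gt0//.
rewrite -[leRHS]mulr1 ler_wpM2l ?mulr_ge0 ?exprn_ge0 ?(ltW mu0)//.
by rewrite ler_pdivrMr// mul1r.
Qed.

End decay.

Theorem theorem5p1 (R : realType) (d : nat) (d_gt0 : (0 < d)%N)
  (Omega0 : set (conf d)) (P : R -> R.-pker (conf d) ~> (conf d))
  (nu : probability (conf d) R)
  (dW : measure_display) (W : measurableType dW) (Pr : probability W R)
  (eta : R -> W -> conf d)
  (D : conf d -> conf d -> R)
  (systemP : is_particle_system Omega0 P)
  (nu_product : homogeneous_product nu)
  (nu_stationary : stationary Omega0 P nu)
  (eta_process : is_markov_process Omega0 P nu Pr eta)
  (D_osd : orthogonal_self_duality Omega0 P nu D)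
  (C : nat -> R)
  (heat_kernel_bound : forall (xi xi' : conf d) (t : R),
     finite_conf xi -> finite_conf xi' -> 0 <= t ->
     (transition_probability P t xi xi'
      <= (C (mass xi) / ((1 + t) `^ ((mass xi)%:R * d%:R / 2)))%:E)%E)
  (k : nat) (k_ge1 : (1 <= k)%N)
  (phi : 'rV[R]_d -> R) (phi_schwartz : schwartz phi) :
  forall T : R, 0 < T ->
  exists CT : R, \forall N \near \oo, forall x : 'I_k -> site d,
    ((N%:R ^- d)%:E *
     \int[lebesgue_measure]_(t in `[0%R, T]) \int[lebesgue_measure]_(s in `[0%R, T])
       'E_Pr[fun w => (field_X D N x (eta (N%:R ^+ 2 * t) w) phi
                       * field_X D N x (eta (N%:R ^+ 2 * s) w) phi)%R]
     <= (CT * N%:R `^ (- (2 * (k%:R - 1) * d%:R / (2 + (k%:R - 1) * d%:R))))%:E)%E.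
Proof.
move=> T T0.
have [dD dF dO] := D_osd.
have [B [B0 [phiB sumB]]] := schwartz_lattice_sum phi_schwartz.
have [a [b [a0 b0 bk exps]]] := decay_exponents R k.-1 d_gt0.
have [K K0 hK] := return_decay systemP dD dF heat_kernel_bound k_ge1 a0 b0 B0.
have [S S0 hS] := second_moment_bounded nu_product dF dO k.
have [e bij_e] := site_enumeration d_gt0.
have e_inj : injective e.
  by move=> i j eij; case: bij_e => _ inj _; apply: inj; rewrite ?inE.
pose be : R := b * k.-1%:R.
have be0 : 0 <= be by rewrite mulr_ge0//; case/andP: b0.
have be1 : be < 1 by [].
pose L : R := 2 * (1 + T) `^ (1 - be) / (1 - be).
have L0 : 0 <= L by rewrite divr_ge0 ?mulr_ge0 ?powR_ge0// subr_ge0 ltW.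
pose C1 : R := S * B * K.
have C10 : 0 <= C1 by rewrite !mulr_ge0.
exists (C1 * L * T); exists 1%N => // N /= N1 x.
have n1 : 1 <= N%:R :> R by rewrite ler1n.
have n0 : 0 < N%:R :> R by lra.
move: sumB => /(_ N _ N1) sumB.
set n : R := N%:R in n1 n0 sumB *.
pose c (z : site d) : R := phi (\row_(i < d) ((z 0 i)%:~R / n)).
have uniq_e m : uniq [seq e i | i <- iota 0 m] by rewrite map_inj_uniq// iota_uniq.
have sum_e m (F : site d -> R) :
    \sum_(i < m) F (e i) = \sum_(w <- [seq e i | i <- iota 0 m]) F w.
  by rewrite big_map (_ : iota 0 m = index_iota 0 m) ?big_mkord// /index_iota subn0.
have sum_c m : \sum_(i < m) `|c (e i)| <= B * n ^+ d.
  by rewrite (sum_e m (fun z => `|c z|)); exact: sumB.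
pose xi z := conf_of (shift_points z x).
have sxi z : sector k (xi z) by exact: sector_shift.
pose x0 := [seq x i | i <- enum 'I_k].
have sx0 : size x0 = k by rewrite size_map size_enum_ord.
have sum_return (r : R) m i : 0 <= r ->
    \sum_(j < m) `|c (e j)| * fine (P r (xi (e i)) [set xi (e j)]) <=
    K * (n `^ a * (1 + r) `^ (- b)) ^+ k.-1.
  move=> r0; rewrite (sum_e m (fun z => `|c z| * fine (P r (xi (e i)) [set xi z]))).
  rewrite {1}/xi conf_of_shift -/x0 (eq_bigr (fun z => `|c z| * fine (P r
    (conf_seq [seq e i + y | y <- x0]) [set conf_seq [seq z + y | y <- x0]]))); last first.
    by move=> z _; rewrite /xi conf_of_shift.
  apply: hK => //; last by rewrite size_map.
  - by move=> w; rewrite normr_ge0 phiB.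
  - exact: sumB.
have corr (t s : R) i j : 0 <= s -> s <= t ->
    `|fine (\int[Pr]_w (D (xi (e i)) (eta t w) * D (xi (e j)) (eta s w))%:E)%E| <=
    S * fine (P (t - s) (xi (e i)) [set xi (e j)]).
  move=> s0 st.
  have ts0 : 0 <= t - s by rewrite subr_ge0.
  have := two_time_correlation systemP nu_product nu_stationary eta_process D_osd
    s0 ts0 (sxi (e i)) (sxi (e j)).
  rewrite subrKC; under eq_integral => w _ do rewrite mulrC.
  move=> ->.
  have pfin : P (t - s) (xi (e i)) [set xi (e j)] \is a fin_num.
    by apply: kernel_fin_num; exact: measurable_conf1.
  have m0 : (0 <= \int[nu]_z (D (xi (e j)) z ^+ 2)%:E)%E.
    by apply: integral_ge0 => z _; rewrite lee_fin sqr_ge0.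
  have mfin : (\int[nu]_z (D (xi (e j)) z ^+ 2)%:E)%E \is a fin_num.
    by rewrite ge0_fin_numE// (le_lt_trans (hS _ (sxi (e j))))// ltry.
  rewrite fineM// ger0_norm ?mulr_ge0 ?fine_ge0// mulrC ler_wpM2r ?fine_ge0//.
  by rewrite -lee_fin fineK// hS.
(* a bound on the covariance at time lag r, uniform in the number m of sites *)
pose G (r : R) := S * (B * n ^+ d) * (K * (n `^ a * (1 + r) `^ (- b)) ^+ k.-1).
have sumG (r : R) m (F : nat -> nat -> R) : 0 <= r ->
    (forall i j, F i j <= S * fine (P r (xi (e i)) [set xi (e j)])) ->
    \sum_(i < m) \sum_(j < m) `|c (e i)| * `|c (e j)| * F i j <= G r.
  move=> r0 hF.
  apply: (@le_trans _ _ (S * \sum_(i < m) `|c (e i)| *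
      \sum_(j < m) `|c (e j)| * fine (P r (xi (e i)) [set xi (e j)]))).
    rewrite mulr_sumr; apply: ler_sum => i _; rewrite !mulr_sumr.
    apply: ler_sum => j _; rewrite -mulrA [leRHS]mulrCA ler_wpM2l// [leRHS]mulrCA ler_wpM2l//.
  rewrite /G -[leRHS]mulrA ler_wpM2l//.
  apply: (@le_trans _ _ (\sum_(i < m) `|c (e i)| *
      (K * (n `^ a * (1 + r) `^ (- b)) ^+ k.-1))).
    by apply: ler_sum => i _; rewrite ler_wpM2l// sum_return.
  rewrite -mulr_suml ler_wpM2r ?sum_c//.
  by rewrite mulr_ge0// exprn_ge0// mulr_ge0// powR_ge0.
have field_le (t s : R) : 0 <= t -> 0 <= s ->
    ('E_Pr[fun w => (field_X D N x (eta t w) phi * field_X D N x (eta s w) phi)%R]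
     <= (G `|t - s|)%:E)%E.
  move=> t0 s0; rewrite unlock.
  apply: (field_covariance_le systemP nu_product nu_stationary eta_process D_osd bij_e
    (c := c) (A := B * n ^+ d)).
  - exact: sum_c.
  - by [].
  - by [].
  move=> q.
  have [st|/ltW ts] := leP s t.
    rewrite ger0_norm ?subr_ge0//.
    apply: (sumG (t - s) q (fun i j =>
      `|fine (\int[Pr]_w (D (xi (e i)) (eta t w) * D (xi (e j)) (eta s w))%:E)%E|)).
      by rewrite subr_ge0.
    by move=> i j; exact: corr.
  (* corr has the later time first *)
  rewrite ler0_norm ?subr_le0// opprB exchange_big/=.
  under eq_bigr => i _ do under eq_bigr => j _ do rewrite [ `|c (e j)| * _]mulrC.
  apply: (sumG (s - t) q (fun j i =>
    `|fine (\int[Pr]_w (D (xi (e i)) (eta t w) * D (xi (e j)) (eta s w))%:E)%E|)).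
    by rewrite subr_ge0.
  move=> i j; apply: le_trans (corr _ _ i j t0 ts).
  rewrite le_eqVlt; apply/orP; left; apply/eqP; congr (`|fine _|).
  by apply: eq_integral => w _; rewrite mulrC.
pose J : R := C1 * n ^+ d * n `^ (a * k.-1%:R).
have J0 : 0 <= J by rewrite mulr_ge0 ?powR_ge0// mulr_ge0// exprn_ge0// ltW.
have GE (r : R) : 0 <= r -> G r = J * (1 + r) `^ (- be).
  move=> r0; rewrite /G exprMn.
  rewrite -(powR_mulrn k.-1 (powR_ge0 n a)) -(powR_mulrn k.-1 (powR_ge0 (1 + r) (- b))).
  by rewrite -!powRrM mulNr -/be /J /C1; ring.
have inner (t : R) : 0 <= t <= T ->
    (\int[lebesgue_measure]_(s in `[0%R, T])
       'E_Pr[fun w => (field_X D N x (eta (n ^+ 2 * t) w) phi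
                       * field_X D N x (eta (n ^+ 2 * s) w) phi)%R]
     <= (J * (L * n `^ (- (2 * be))))%:E)%E.
  move=> tT; have /andP[t0 _] := tT.
  apply: (@le_trans _ _ (\int[lebesgue_measure]_(s in `[0%R, T])
    (J%:E * ((1 + n ^+ 2 * `|t - s|) `^ (- be))%:E))%E).
    apply: le_integral_majorant => s /=; rewrite in_itv/= => /andP[s0 _].
      by rewrite -EFinM lee_fin mulr_ge0// powR_ge0.
    have n20 : 0 <= n ^+ 2 by rewrite sqr_ge0.
    apply: (le_trans (field_le _ _ _ _)); rewrite ?mulr_ge0//.
    by rewrite GE// -mulrBr normrM (ger0_norm n20).
  rewrite ge0_integralZl_EFin//.
  - rewrite (EFinM J); apply: lee_wpmul2l; rewrite ?lee_fin//; exact: time_integral_le.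
  - by move=> s _; rewrite lee_fin powR_ge0.
  - exact: measurable_decay.
have L1 : 0 <= J * (L * n `^ (- (2 * be))).
  by apply: mulr_ge0 => //; apply: mulr_ge0 => //; exact: powR_ge0.
apply: (@le_trans _ _ ((n ^- d)%:E * (J * (L * n `^ (- (2 * be))) * T)%:E)%E).
  rewrite lee_wpmul2l ?lee_fin ?invr_ge0 ?exprn_ge0 ?(ltW n0)//.
  apply: (@le_trans _ _ (\int[lebesgue_measure]_(t in `[0%R, T])
    (cst (J * (L * n `^ (- (2 * be))))%:E t))%E).
    apply: le_integral_majorant => t /=; first by rewrite lee_fin.
    by rewrite in_itv/=; exact: inner.
  rewrite integral_cst//= lebesgue_measure_itv/= lte_fin T0 -EFinB subr0.
  by rewrite -EFinM.
rewrite -EFinM lee_fin.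
have -> : n ^- d * (J * (L * n `^ (- (2 * be))) * T) =
    C1 * L * T * (n `^ (a * k.-1%:R) * n `^ (- (2 * be))).
  by rewrite /J; field; rewrite expf_neq0 ?gt_eqF.
have CT0 : 0 <= C1 * L * T by apply: mulr_ge0 (ltW T0); exact: mulr_ge0.
rewrite ler_wpM2l// -powRD; last first.
  by apply/implyP => _; rewrite gt_eqF.
apply: ler_powR => //.
have k1 : k%:R - 1 = k.-1%:R :> R by rewrite -[in LHS](prednK k_ge1) -natr1 addrK.
rewrite k1 /be; lra.
Qed.
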